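(* There exist (dyadic) wavelet sets $E,F\subseteq\mathbb{R}$ such that $\mathcal{D}_E^F=\mathcal{D}_F^E$ (modulo null sets) but $(E,F)$ is not an interpolation pair, i.e. it is not the case that $\sigma_E^F\circ\sigma_E^F=\mathrm{id}_{\mathbb{R}}$ almost everywhere.
   Context: All sets are Lebesgue measurable, $\mu$ is Lebesgue measure, and all equalities, inclusions and bijections between sets, and equalities between maps, are understood modulo null sets (almost everywhere). A dyadic orthonormal wavelet is a function $\psi\in L^2(\mathbb{R})$ such that $\{2^{n/2}\psi(2^n\cdot - l) : n,l\in\mathbb{Z}\}$ is an orthonormal basis of $L^2(\mathbb{R})$. With the Fourier transform $(\mathcal{F}f)(s)=\frac{1}{\sqrt{2\pi}}\int_{\mathbb{R}}e^{-ist}f(t)\,dt$, a measurable set $E\subseteq\mathbb{R}$ is a wavelet set if $\mathcal{F}^{-1}\big(\frac{1}{\sqrt{\mu(E)}}\chi_E\big)$ is a dyadic orthonormal wavelet. A known characterization: $E$ is a wavelet set if and only if both $\{E+2n\pi\}_{n\in\mathbb{Z}}$ and $\{2^nE\}_{n\in\mathbb{Z}}$ are measurable partitions of $\mathbb{R}$. (A sequence of measurable sets $\{E_n\}$ is a measurable partition of $E$ if $E\,\Delta\,\bigcup_n E_n$ is null and $E_n\cap E_m$ is null for $n\neq m$.) Interpolation map: for wavelet sets $E,F$, for almost every $s\in E$ there is a unique $n\in\mathbb{Z}$ with $s+2n\pi\in F$, and one sets $\sigma_E^F(s)=s+2n\pi$; this is a bijection $E\to F$ modulo null sets. It is extended to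 a measurable bijection (modulo null sets) of $\mathbb{R}$ by $\sigma_E^F(0)=0$ and $\sigma_E^F(s)=2^n\sigma_E^F(2^{-n}s)$ for $s\in 2^nE$, $n\in\mathbb{Z}$. The pair $(E,F)$ is an interpolation pair if $\sigma_E^F\circ\sigma_E^F=\mathrm{id}_{\mathbb{R}}$. The domain of $2\pi$-congruence of $\sigma_E^F$, denoted $\mathcal{D}_E^F$, is the set of all $s\in\mathbb{R}$ such that $\sigma_E^F(s)-s$ is an integral multiple of $2\pi$; $\mathcal{D}_F^E$ is the analogous set for $\sigma_F^E$. *)

(* Defs.v *)
From mathcomp Require Import all_boot all_order all_algebra.
From mathcomp Require Import all_classical all_reals all_analysis.
From mathcomp.real_closed Require Import complex.

Set Implicit Arguments.
Unset Strict Implicit.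
Unset Printing Implicit Defensive.

Import Order.TTheory GRing.Theory Num.Theory.
Import numFieldNormedType.Exports.

Local Open Scope classical_set_scope.
Local Open Scope complex_scope.
Local Open Scope ring_scope.

(* Measurable sets and functions are Borel measurable;
   since a Lebesgue measurable set or function agrees a.e. with a Borel one and
   everything below is insensitive to null sets, nothing is lost. *)

Section L2.
Context {R : realType}.
Implicit Types f g : R -> R[i].
Let mu := @lebesgue_measure R.

Definition cexpi (x : R) : R[i] := cos x +i* sin x.

(* Complex Lebesgue integral over the line, componentwise; meaningful when both
   components are integrable. *)
Definition cintegral f : R[i] :=
  Rintegral mu setT (fun t => complex.Re (f t)) +i*
  Rintegral mu setT (fun t => complex.Im (f t)).

Definition L2norm f : \bar R := ('N[mu]_2%:E[(fun t => (Normc.normc (f t))%:E)])%E.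

Definition L2 f : Prop :=
  [/\ measurable_fun [set: measurableTypeR R] (fun t => complex.Re (f t)),
      measurable_fun [set: measurableTypeR R] (fun t => complex.Im (f t)) &
      (L2norm f < +oo)%E].

Definition L2dot f g : R[i] := cintegral (fun t => f t * conjc (g t)).

Definition L2_orthonormal_basis (I : choiceType) (e : I -> R -> R[i]) : Prop :=
  [/\ forall i, L2 (e i),
      forall i j, L2dot (e i) (e j) = (i == j)%:R &
      forall f, L2 f -> forall eps : R, 0 < eps ->
        exists (s : seq I) (c : I -> R[i]),
          (L2norm (fun t => f t - \sum_(i <- s) c i * e i t)%R < eps%:E)%E].

End L2.

Section Wavelets.
Context {R : realType}.
Implicit Types (psi : R -> R[i]) (E F : set R).
Let mu := @lebesgue_measure R.

Definition dyadic_translate psi (nl : int * int) (t : R) : R[i] :=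
  ((2 : R) `^ (nl.1%:~R / 2))%:C * psi ((2 : R) ^ nl.1 * t - nl.2%:~R).

Definition orthonormal_wavelet psi : Prop :=
  L2 psi /\ L2_orthonormal_basis (dyadic_translate psi).

(* For integrable and square-integrable g, in particular for the normalized indicator of a set of
   finite measure, the L2 inverse Fourier transform is given by this integral. *)
Definition inverse_fourier (g : R -> R[i]) (t : R) : R[i] :=
  ((Num.sqrt (2 * pi))^-1)%:C * cintegral (fun s => cexpi (s * t) * g s).

Definition wavelet_set E : Prop :=
  [/\ @measurable _ (measurableTypeR R) E, (0 < mu E < +oo)%E &
      orthonormal_wavelet
        (inverse_fourier (fun s => (\1_E s / Num.sqrt (fine (mu E)))%:C))].

(* Where the integers n with s + 2 n pi in F, or with s in 2^n E, fail to exist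
   or to be unique the value is arbitrary; for wavelet sets E and F this happens
   only on a null set. *)
Definition translation_map F (s : R) : R :=
  s + 2 * (xget 0 [set n : int | F (s + 2 * n%:~R * pi)])%:~R * pi.

Definition interpolation_map E F (s : R) : R :=
  if s == 0 then 0 else
  let n := xget 0 [set n : int | E ((2 : R) ^ (- n) * s)] in
  2 ^ n * translation_map F (2 ^ (- n) * s).

Definition interpolation_pair E F : Prop :=
  {ae mu, forall s, interpolation_map E F (interpolation_map E F s) = s}.

Definition congruence_domain E F : set R :=
  [set s | exists n : int, interpolation_map E F s - s = 2 * n%:~R * pi].

End Wavelets.

(* Main.v *)
(** The map sigma = sigma_E^F is the identity except on four small pieces of E, where it is a
    4-cycle modulo dilation. In units of 2 pi / 21, with y in [2, 2 + 1/2), the points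
    y, y - 21, y - 42 and y - 315 differ by multiples of 21; the pieces of E are
    4 y, 2 (y - 21), 8 (y - 42), y - 315, and those of F are 4 (y - 21), 2 (y - 42), 8 (y - 315), y.
    Hence sigma maps y -> y - 21 -> y - 42 -> y - 315 -> y, and sigma^2 is not the identity. As
    the successive jumps are odd multiples of 21, sigma (2^n e) - 2^n e is an integral multiple of
    2 pi exactly when 2^n e is 2^p times one of the four points with p >= 0, and the same
    criterion describes the domain of the inverse map.

    E and F are unions of half-open intervals, so that they tile the line exactly both by 2 pi
    translations and, the origin excepted, by dyadic dilations; the latter holds since each is
    2 S \ S for a bounded neighbourhood S of 0 with S contained in 2 S.

    Such tilings give wavelets: the transforms of the dyadic translates of psi are the
    exponentials normalized on 2^n E. Orthonormality follows from Plancherel and completeness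
    from summing Parseval's identity over the dilates of E, once the translates of E have been
    folded onto [- pi, pi). Parseval on [- pi, pi) rests on the convergence of
    (1 - x^n)^(2^n) to the indicator of x < 1/2, applied to a trigonometric polynomial x that
    crosses 1/2 only at b; Plancherel for a function f supported in [- pi, pi) is obtained by
    integrating Parseval's identity for f(t) exp(- i theta t) over theta in [0, 1). *)

Require Import Defs.
From mathcomp Require Import all_boot all_order all_algebra.
From mathcomp Require Import all_classical all_reals all_analysis.
From mathcomp.real_closed Require Import complex.
From mathcomp Require Import measurable_realfun zify ring lra.

Set Implicit Arguments.
Unset Strict Implicit.
Unset Printing Implicit Defensive.

Import Order.TTheory GRing.Theory Num.Theory.
Import numFieldNormedType.Exports.

Local Open Scope classical_set_scope.
Local Open Scope complex_scope.
Local Open Scope ring_scope.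

(** * Square-integrable complex functions *)

Section ComplexFunctions.
Context {R : realType}.
Local Notation mu := (@lebesgue_measure R).
Local Notation TR := (measurableTypeR R).
Local Notation cRe := complex.Re.
Local Notation cIm := complex.Im.
Implicit Types (f g : R -> R[i]) (z c : R[i]).

(** The squared modulus, kept as a polynomial in the two components rather than through [normc], so
    that [ring] and [nra] apply. *)
Definition nsq z : R := cRe z ^+ 2 + cIm z ^+ 2.

Lemma cReD z c : cRe (z + c) = cRe z + cRe c. Proof. by case: z c => ? ? []. Qed.
Lemma cImD z c : cIm (z + c) = cIm z + cIm c. Proof. by case: z c => ? ? []. Qed.
Lemma cReN z : cRe (- z) = - cRe z. Proof. by case: z. Qed.
Lemma cImN z : cIm (- z) = - cIm z. Proof. by case: z. Qed.
Lemma cReM z c : cRe (z * c) = cRe z * cRe c - cIm z * cIm c.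
Proof. by case: z c => ? ? []. Qed.
Lemma cImM z c : cIm (z * c) = cRe z * cIm c + cIm z * cRe c.
Proof. by case: z c => ? ? []. Qed.
Lemma cRe_conj z : cRe z^*%C = cRe z. Proof. by case: z. Qed.
Lemma cIm_conj z : cIm z^*%C = - cIm z. Proof. by case: z. Qed.
Definition ReImE := (cReD, cImD, cReN, cImN, cReM, cImM, cRe_conj, cIm_conj).

Lemma complex_ext z c : cRe z = cRe c -> cIm z = cIm c -> z = c.
Proof. by case: z c => ? ? [? ?] /= -> ->. Qed.

Lemma nsq_ge0 z : 0 <= nsq z. Proof. by rewrite addr_ge0// sqr_ge0. Qed.
Lemma nsqM z c : nsq (z * c) = nsq z * nsq c.
Proof. by rewrite /nsq !ReImE; ring. Qed.
Lemma nsqN z : nsq (- z) = nsq z. Proof. by rewrite /nsq !ReImE; ring. Qed.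
Lemma nsq_conj z : nsq z^*%C = nsq z. Proof. by rewrite /nsq !ReImE; ring. Qed.
Lemma nsqD_le z c : nsq (z + c) <= 2 * nsq z + 2 * nsq c.
Proof.
rewrite /nsq !ReImE.
have := sqr_ge0 (cRe z - cRe c); have := sqr_ge0 (cIm z - cIm c); nra.
Qed.
Lemma nsq_real (x : R) : nsq x%:C = x ^+ 2. Proof. by rewrite /nsq/= expr0n addr0. Qed.
Lemma mul_conjc z : z * z^*%C = (nsq z)%:C.
Proof. by apply: complex_ext; rewrite !ReImE /nsq/=; ring. Qed.
Lemma conjcD z c : (z + c)^*%C = z^*%C + c^*%C.
Proof. by apply: complex_ext; rewrite !ReImE //; ring. Qed.
Lemma conjcM z c : (z * c)^*%C = z^*%C * c^*%C.
Proof. by apply: complex_ext; rewrite !ReImE; ring. Qed.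
Lemma conjc_realM (x : R) z : (x%:C * z)^*%C = x%:C * z^*%C.
Proof. by apply: complex_ext; rewrite !ReImE/=; ring. Qed.
Lemma nsq0 : nsq 0 = 0. Proof. by rewrite /nsq/= expr0n addr0. Qed.

Definition cmeas f := measurable_fun [set: TR] (fun t => cRe (f t)) /\
                     measurable_fun [set: TR] (fun t => cIm (f t)).

Lemma eq_cmeas f g : f =1 g -> cmeas f -> cmeas g. Proof. by move/funext => ->. Qed.
Lemma cmeas_cst z : cmeas (fun=> z). Proof. by split; exact: measurable_cst. Qed.
Lemma cmeasD f g : cmeas f -> cmeas g -> cmeas (fun t => f t + g t).
Proof.
move=> [f1 f2] [g1 g2]; split.
- by under eq_fun do rewrite cReD; exact: measurable_funD.
- by under eq_fun do rewrite cImD; exact: measurable_funD.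
Qed.
Lemma cmeasM f g : cmeas f -> cmeas g -> cmeas (fun t => f t * g t).
Proof.
move=> [f1 f2] [g1 g2]; split.
- by under eq_fun do rewrite cReM; apply: measurable_funB; exact: measurable_funM.
- by under eq_fun do rewrite cImM; apply: measurable_funD; exact: measurable_funM.
Qed.
Lemma cmeas_conj f : cmeas f -> cmeas (fun t => (f t)^*%C).
Proof.
move=> [f1 f2]; split.
- by under eq_fun do rewrite cRe_conj.
- by under eq_fun do rewrite cIm_conj; exact: measurable_funN.
Qed.
Lemma cmeasZ c f : cmeas f -> cmeas (fun t => c * f t).
Proof. by apply: cmeasM; exact: cmeas_cst. Qed.
Lemma cmeas_real (h : R -> R) : measurable_fun [set: TR] h -> cmeas (fun t => (h t)%:C).
Proof. by split => //=; exact: measurable_cst. Qed.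
Lemma cmeas_sum (I : Type) (s : seq I) (F : I -> R -> R[i]) :
  (forall i, cmeas (F i)) -> cmeas (fun t => \sum_(i <- s) F i t).
Proof.
move=> mF; elim: s => [|i s IH].
  by under eq_fun do rewrite big_nil; exact: cmeas_cst.
by under eq_fun do rewrite big_cons; exact: cmeasD.
Qed.
Lemma measurable_nsq f : cmeas f -> measurable_fun [set: TR] (fun t => nsq (f t)).
Proof. by move=> [f1 f2]; apply: measurable_funD; exact: measurable_funX. Qed.
Lemma cmeas_comp f (h : R -> R) : measurable_fun [set: TR] (h : TR -> TR) ->
  cmeas f -> cmeas (f \o h).
Proof.
move=> mh [f1 f2]; split.
- exact: (measurableT_comp f1 mh).
- exact: (measurableT_comp f2 mh).
Qed.

Definition rint (h : R -> R) := mu.-integrable [set: TR] (EFin \o h).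

Definition cint f := rint (fun t => cRe (f t)) /\ rint (fun t => cIm (f t)).

Lemma eq_rint (g h : R -> R) : g =1 h -> rint g -> rint h.
Proof. by move/funext => ->. Qed.
Lemma rint_cmeas (h : R -> R) : rint h -> measurable_fun [set: TR] h.
Proof. by move/measurable_int/measurable_EFinP. Qed.
Lemma rintD (g h : R -> R) : rint g -> rint h -> rint (fun t => g t + h t).
Proof.
by move=> ig ih; rewrite /rint (_ : _ \o _ = (EFin \o g) \+ (EFin \o h))%E//; exact: integrableD.
Qed.
Lemma rintZ (k : R) (h : R -> R) : rint h -> rint (fun t => k * h t).
Proof.
move=> ih; rewrite /rint (_ : _ \o _ = (fun x => k%:E * (EFin \o h) x)%E)//.
exact: integrableZl.
Qed.
Lemma rintN (h : R -> R) : rint h -> rint (fun t => - h t).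
Proof. by move/(rintZ (-1)); apply: eq_rint => t; rewrite mulN1r. Qed.
Lemma le_rint (g h : R -> R) : measurable_fun [set: TR] g -> (forall t, `|g t| <= h t) ->
  rint h -> rint g.
Proof.
move=> mg gh; apply: le_integrable => //; first exact/measurable_EFinP.
by move=> t _; rewrite /= lee_fin (le_trans (gh t))// ler_norm.
Qed.
Lemma RintD (g h : R -> R) : rint g -> rint h ->
  \int[mu]_t (g t + h t) = \int[mu]_t g t + \int[mu]_t h t.
Proof. by move=> ? ?; exact: RintegralD. Qed.
Lemma RintZ (k : R) (h : R -> R) : rint h -> \int[mu]_t (k * h t) = k * \int[mu]_t h t.
Proof. by move=> ?; exact: RintegralZl. Qed.
Lemma RintN (h : R -> R) : rint h -> \int[mu]_t (- h t) = - \int[mu]_t h t.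
Proof.
by move=> ?; rewrite -mulN1r -RintZ//; apply: eq_Rintegral => x _; rewrite mulN1r.
Qed.
Lemma RintB (g h : R -> R) : rint g -> rint h ->
  \int[mu]_t (g t - h t) = \int[mu]_t g t - \int[mu]_t h t.
Proof. by move=> ? ?; exact: RintegralB. Qed.

Lemma eq_cint f g : f =1 g -> cint f -> cint g. Proof. by move/funext => ->. Qed.
Lemma cint_conj f : cint f -> cint (fun t => (f t)^*%C).
Proof.
move=> [f1 f2]; split.
- by under eq_fun do rewrite cRe_conj.
- by under eq_fun do rewrite cIm_conj; exact: rintN.
Qed.
Lemma le_cint f (h : R -> R) : cmeas f -> (forall t, `|cRe (f t)| <= h t) ->
  (forall t, `|cIm (f t)| <= h t) -> rint h -> cint f.
Proof. by move=> [f1 f2] hf1 hf2 ih; split; exact: le_rint ih. Qed.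

Lemma eq_cintegral f g : f =1 g -> cintegral f = cintegral g.
Proof. by move/funext => ->. Qed.
Lemma cintegralD f g : cint f -> cint g ->
  cintegral (fun t => f t + g t) = cintegral f + cintegral g.
Proof.
move=> [f1 f2] [g1 g2]; rewrite /cintegral; apply: complex_ext => /=.
- by under eq_Rintegral do rewrite cReD; exact: RintD.
- by under eq_Rintegral do rewrite cImD; exact: RintD.
Qed.
Lemma cintegralZ c f : cint f -> cintegral (fun t => c * f t) = c * cintegral f.
Proof.
move=> [f1 f2]; rewrite /cintegral; apply: complex_ext; rewrite ?(cReM, cImM)/=.
- under eq_Rintegral do rewrite cReM.
  by rewrite RintB ?RintZ//; exact: rintZ.
- under eq_Rintegral do rewrite cImM.
  by rewrite RintD ?RintZ//; exact: rintZ.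
Qed.
Lemma cintegral_conj f : cint f -> cintegral (fun t => (f t)^*%C) = (cintegral f)^*%C.
Proof.
move=> [f1 f2]; rewrite /cintegral; apply: complex_ext => /=.
- by under eq_Rintegral do rewrite cRe_conj.
- by under eq_Rintegral do rewrite cIm_conj; exact: RintN.
Qed.

Lemma rint_lty (h : R -> R) : measurable_fun [set: TR] h -> (forall t, 0 <= h t) ->
  (\int[mu]_t (h t)%:E < +oo)%E -> rint h.
Proof.
move=> mh h0 hoo; apply/integrableP; split; first exact/measurable_EFinP.
by under eq_integral do rewrite /= ger0_norm//.
Qed.
Lemma Rint_EFin (h : R -> R) : rint h -> (\int[mu]_t h t)%:E = (\int[mu]_t (h t)%:E)%E.
Proof. by move=> ih; rewrite fineK//; exact: integrable_fin_num. Qed.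

Lemma L2norm_nsq f : L2norm f = ((\int[mu]_t (nsq (f t))%:E) `^ 2^-1)%E.
Proof.
rewrite /L2norm unlock; congr (_ `^ _)%E; apply: eq_integral => t _.
rewrite /= ger0_norm; last by case: (f t) => a b /=; rewrite sqrtr_ge0.
congr EFin; rewrite powR_mulrn; last by case: (f t) => a b /=; rewrite sqrtr_ge0.
by rewrite /nsq; case: (f t) => a b /=; rewrite sqr_sqrtr// addr_ge0// sqr_ge0.
Qed.

Lemma integral_nsq_ge0 f : (0 <= \int[mu]_t (nsq (f t))%:E)%E.
Proof. by apply: integral_ge0 => t _; rewrite lee_fin nsq_ge0. Qed.

(** An infinite integral has an infinite square root, so [L2norm] is finite exactly when the
    integral of [nsq] is. *)
Lemma L2P f : L2 f <-> cmeas f /\ rint (fun t => nsq (f t)).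
Proof.
rewrite /L2 L2norm_nsq; split => [[f1 f2 fn]|[[f1 f2] fn]].
  split=> //; apply: rint_lty; [exact: measurable_nsq | move=> t; exact: nsq_ge0|].
  move: fn; case: (integral _ _ _) (integral_nsq_ge0 f) => [r| |]//.
    by move=> _ _; exact: ltry.
  by move=> _; rewrite poweRyr// gt_eqF.
split => //; apply: poweR_lty; exact: (integrable_lty _ fn).
Qed.

(** The squared L2 norm as a real number. It is faithful on [L2] functions only, since [fine] sends
    an infinite integral to 0. *)
Definition nrm2 f : R := \int[mu]_t nsq (f t).

Lemma nrm2_ge0 f : 0 <= nrm2 f.
Proof. by apply: Rintegral_ge0 => t _; exact: nsq_ge0. Qed.
Lemma nrm2E f : L2 f -> (nrm2 f)%:E = (\int[mu]_t (nsq (f t))%:E)%E.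
Proof. by move/L2P => [_ fi]; exact: Rint_EFin. Qed.
Lemma eq_nrm2 f g : f =1 g -> nrm2 f = nrm2 g. Proof. by move/funext => ->. Qed.

Lemma L2norm_lt f (eps : R) : L2 f -> 0 < eps -> nrm2 f < eps ^+ 2 -> (L2norm f < eps%:E)%E.
Proof.
move=> fL eps0 fe; rewrite L2norm_nsq -nrm2E// poweR_EFin lte_fin.
by rewrite powR12_sqrt ?nrm2_ge0// -[ltRHS](ger0_norm (ltW eps0)) -sqrtr_sqr ltr_sqrt// exprn_gt0.
Qed.

Lemma eq_L2 f g : f =1 g -> L2 f -> L2 g. Proof. by move/funext => ->. Qed.
Lemma L2_cmeas f : L2 f -> cmeas f. Proof. by move/L2P => []. Qed.
Lemma L2_rint f : L2 f -> rint (fun t => nsq (f t)). Proof. by move/L2P => []. Qed.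
Lemma L2_le f (h : R -> R) : cmeas f -> (forall t, nsq (f t) <= h t) -> rint h -> L2 f.
Proof.
move=> mf fh ih; apply/L2P; split=> //; apply: le_rint ih; first exact: measurable_nsq.
by move=> t; rewrite ger0_norm ?nsq_ge0.
Qed.
Lemma L2D f g : L2 f -> L2 g -> L2 (fun t => f t + g t).
Proof.
move=> /L2P[mf f2] /L2P[mg g2]; apply: (@L2_le _ (fun t => 2 * nsq (f t) + 2 * nsq (g t))).
- exact: cmeasD.
- by move=> t; exact: nsqD_le.
- by apply: rintD; exact: rintZ.
Qed.
Lemma L2Z c f : L2 f -> L2 (fun t => c * f t).
Proof.
move=> /L2P[mf f2]; apply/L2P; split; first exact: cmeasZ.
by under eq_fun do rewrite nsqM; exact: rintZ.
Qed.
Lemma L2N f : L2 f -> L2 (fun t => - f t).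
Proof. by move/(L2Z (-1)); apply: eq_L2 => t; rewrite mulN1r. Qed.
Lemma L2B f g : L2 f -> L2 g -> L2 (fun t => f t - g t).
Proof. by move=> fL gL; apply: L2D => //; exact: L2N. Qed.
Lemma L2_0 : L2 (fun=> 0 : R[i]).
Proof.
apply: (@L2_le _ (fun=> 0)) => [|t|]; [exact: cmeas_cst|by rewrite nsq0|].
exact: integrable0.
Qed.
Lemma L2_sum (I : Type) (s : seq I) (F : I -> R -> R[i]) :
  (forall i, L2 (F i)) -> L2 (fun t => \sum_(i <- s) F i t).
Proof.
move=> mF; elim: s => [|i s IH].
  by under eq_fun do rewrite big_nil; exact: L2_0.
by under eq_fun do rewrite big_cons; exact: L2D.
Qed.
Lemma L2_bounded_mul f g (B : R) : cmeas f -> (forall t, nsq (f t) <= B) -> L2 g ->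
  L2 (fun t => f t * g t).
Proof.
move=> mf fB /L2P[mg g2]; apply: (@L2_le _ (fun t => B * nsq (g t))).
- exact: cmeasM.
- by move=> t; rewrite nsqM ler_wpM2r// nsq_ge0.
- exact: rintZ.
Qed.
Lemma L2_conj f : L2 f -> L2 (fun t => (f t)^*%C).
Proof.
move=> /L2P[mf f2]; apply/L2P; split; first exact: cmeas_conj.
by under eq_fun do rewrite nsq_conj.
Qed.

(** By 2 a b <= a^2 + b^2, applied to the products of components, both parts of the product are
    bounded by [nsq (f t) + nsq (g t)]. *)
Lemma cint_L2M f g : L2 f -> L2 g -> cint (fun t => f t * g t).
Proof.
move=> /L2P[mf f2] /L2P[mg g2]; apply: (@le_cint _ (fun t => nsq (f t) + nsq (g t))).
- exact: cmeasM.
- move=> t; rewrite cReM /nsq ler_norml.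
  case: (f t) (g t) => a b [c d] /=.
  by apply/andP; split; have := sqr_ge0 (a - c); have := sqr_ge0 (a + c);
    have := sqr_ge0 (b - d); have := sqr_ge0 (b + d); nra.
- move=> t; rewrite cImM /nsq ler_norml.
  case: (f t) (g t) => a b [c d] /=.
  by apply/andP; split; have := sqr_ge0 (a - d); have := sqr_ge0 (a + d);
    have := sqr_ge0 (b - c); have := sqr_ge0 (b + c); nra.
- exact: rintD.
Qed.
Lemma cint_dot f g : L2 f -> L2 g -> cint (fun t => f t * (g t)^*%C).
Proof. by move=> fL gL; apply: cint_L2M => //; exact: L2_conj. Qed.

Lemma L2dotDl f g (h : R -> R[i]) : L2 f -> L2 g -> L2 h ->
  L2dot (fun t => f t + g t) h = L2dot f h + L2dot g h.
Proof.
move=> fL gL hL; rewrite /L2dot -cintegralD; [|exact: cint_dot..].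
by apply: eq_cintegral => t; rewrite mulrDl.
Qed.
Lemma L2dotZl c f (h : R -> R[i]) : L2 f -> L2 h -> L2dot (fun t => c * f t) h = c * L2dot f h.
Proof.
move=> fL hL; rewrite /L2dot -cintegralZ; [|exact: cint_dot..].
by apply: eq_cintegral => t; rewrite mulrA.
Qed.
Lemma L2dotC f g : L2 f -> L2 g -> L2dot g f = (L2dot f g)^*%C.
Proof.
move=> fL gL; rewrite /L2dot -cintegral_conj; last exact: cint_dot.
by apply: eq_cintegral => t; apply: complex_ext; rewrite !ReImE; ring.
Qed.
Lemma L2dotDr f g (h : R -> R[i]) : L2 f -> L2 g -> L2 h ->
  L2dot h (fun t => f t + g t) = L2dot h f + L2dot h g.
Proof.
move=> fL gL hL; rewrite (@L2dotC _ h)//; last exact: L2D.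
by rewrite L2dotDl// conjcD -!L2dotC.
Qed.
Lemma L2dotZr c f (h : R -> R[i]) : L2 f -> L2 h -> L2dot h (fun t => c * f t) = c^*%C * L2dot h f.
Proof.
move=> fL hL; rewrite (@L2dotC _ h)//; last exact: L2Z.
by rewrite L2dotZl// conjcM -!L2dotC.
Qed.
Lemma L2dotNl f (h : R -> R[i]) : L2 f -> L2 h -> L2dot (fun t => - f t) h = - L2dot f h.
Proof.
move=> fL hL; rewrite -mulN1r -L2dotZl//; congr L2dot.
by apply/funext => t; rewrite mulN1r.
Qed.
Lemma L2dotBl f g (h : R -> R[i]) : L2 f -> L2 g -> L2 h ->
  L2dot (fun t => f t - g t) h = L2dot f h - L2dot g h.
Proof. by move=> fL gL hL; rewrite L2dotDl ?L2dotNl//; exact: L2N. Qed.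
Lemma L2dot0l (h : R -> R[i]) : L2 h -> L2dot (fun=> 0) h = 0.
Proof.
move=> hL; rewrite -[RHS](mul0r (L2dot h h)) -L2dotZl//; congr L2dot.
by apply/funext => t; rewrite mul0r.
Qed.
Lemma L2dot_suml (I : Type) (s : seq I) (F : I -> R -> R[i]) (h : R -> R[i]) :
  (forall i, L2 (F i)) -> L2 h ->
  L2dot (fun t => \sum_(i <- s) F i t) h = \sum_(i <- s) L2dot (F i) h.
Proof.
move=> FL hL; elim: s => [|i s IH].
  by under eq_fun do rewrite big_nil; rewrite big_nil L2dot0l.
under eq_fun do rewrite big_cons.
by rewrite big_cons L2dotDl ?IH//; exact: L2_sum.
Qed.
Lemma L2dot_self f : L2dot f f = (nrm2 f)%:C.
Proof.
rewrite /L2dot /cintegral; apply: complex_ext => /=.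
- by apply: eq_Rintegral => t _; rewrite mul_conjc.
- under eq_Rintegral do rewrite mul_conjc/=.
  by rewrite /Rintegral integral0.
Qed.
Lemma nrm2D f g : L2 f -> L2 g ->
  nrm2 (fun t => f t + g t) = nrm2 f + nrm2 g + 2 * cRe (L2dot f g).
Proof.
move=> fL gL; have := L2dot_self (fun t => f t + g t).
have fgL := L2D fL gL.
rewrite L2dotDl// !L2dotDr// !L2dot_self (L2dotC fL gL) => /(congr1 (@complex.Re R)).
by move: (L2dot f g) => w; rewrite !ReImE /= => <-; ring.
Qed.
Lemma nrm2Z c f : L2 f -> nrm2 (fun t => c * f t) = nsq c * nrm2 f.
Proof.
move=> fL; rewrite /nrm2 -RintZ; last exact: L2_rint.
by apply: eq_Rintegral => t _; rewrite nsqM.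
Qed.
Lemma nrm2N f : nrm2 (fun t => - f t) = nrm2 f.
Proof. by apply: eq_Rintegral => t _; rewrite nsqN. Qed.
Lemma nrm2B f g : L2 f -> L2 g ->
  nrm2 (fun t => f t - g t) = nrm2 f + nrm2 g - 2 * cRe (L2dot f g).
Proof.
move=> fL gL; rewrite nrm2D//; last exact: L2N.
rewrite nrm2N (L2dotC (L2N gL) fL) L2dotNl// (L2dotC fL gL) !ReImE; ring.
Qed.
(** The parallelogram law with the norm of f - g dropped; it replaces the triangle inequality for
    squared norms. *)
Lemma nrm2D_le f g : L2 f -> L2 g ->
  nrm2 (fun t => f t + g t) <= 2 * nrm2 f + 2 * nrm2 g.
Proof.
move=> fL gL; have := nrm2_ge0 (fun t => f t - g t).
by rewrite nrm2B// nrm2D//; lra.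
Qed.

End ComplexFunctions.

(** * Orthonormal families *)

Section Orthonormal.
Context {R : realType} (I : choiceType) (e : I -> R -> R[i]).
Local Notation cRe := (@complex.Re R).
Implicit Types (f g : R -> R[i]) (s : seq I) (ps : seq (I * R[i])).

Definition lincomb ps (t : R) : R[i] := \sum_(p <- ps) p.2 * e p.1 t.

(** Membership in the closed linear span of [e]. An index may occur several times in the list, so
    that adding combinations is concatenation. *)
Definition approximable f : Prop :=
  forall eps : R, 0 < eps -> exists ps, nrm2 (fun t => f t - lincomb ps t) < eps.

Hypothesis eL2 : forall i, L2 (e i).

Lemma L2_lincomb ps : L2 (lincomb ps).
Proof. by apply: L2_sum => p; exact: L2Z. Qed.

Lemma approximable_lincomb ps : approximable (lincomb ps).
Proof.
move=> eps eps0; exists ps; rewrite (_ : nrm2 _ = 0)//.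
rewrite -[RHS](_ : nrm2 (fun=> 0 : R[i]) = 0); last first.
  by rewrite /nrm2; under eq_Rintegral do rewrite nsq0; rewrite Rintegral_cst// mul0r.
by apply: eq_nrm2 => t; rewrite subrr.
Qed.

Lemma approximableD f g : L2 f -> L2 g -> approximable f -> approximable g ->
  approximable (fun t => f t + g t).
Proof.
move=> fL gL fA gA eps eps0.
(* [nrm2D_le] doubles each error, so two errors below eps / 4 add up to less than eps. *)
have [ps psP] := fA (eps / 4) ltac:(lra).
have [qs qsP] := gA (eps / 4) ltac:(lra).
exists (ps ++ qs).
rewrite (@eq_nrm2 _ _ (fun t => (f t - lincomb ps t) + (g t - lincomb qs t))); last first.
  by move=> t; rewrite /lincomb big_cat/=; ring.
apply: le_lt_trans (nrm2D_le _ _) _.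
- by apply: L2B => //; exact: L2_lincomb.
- by apply: L2B => //; exact: L2_lincomb.
- lra.
Qed.

Lemma approximableZ c f : L2 f -> approximable f -> approximable (fun t => c * f t).
Proof.
move=> fL fA eps eps0.
(* Adding 1 keeps the divisor positive even when c is 0. *)
have c0 : 0 < nsq c + 1 by rewrite ltr_wpDl// nsq_ge0.
have [ps psP] := fA (eps / (nsq c + 1)) ltac:(exact: divr_gt0).
exists [seq (p.1, c * p.2) | p <- ps].
rewrite (@eq_nrm2 _ _ (fun t => c * (f t - lincomb ps t))); last first.
  move=> t; rewrite /lincomb big_map/= mulrBr; congr (_ - _).
  by rewrite big_distrr/=; apply: eq_bigr => p _; rewrite mulrA.
rewrite nrm2Z; last by apply: L2B => //; exact: L2_lincomb.
move: psP; rewrite ltr_pdivlMr// => psP.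
apply: le_lt_trans psP; rewrite mulrC ler_wpM2l ?nrm2_ge0//; lra.
Qed.

Lemma approximable_sum (J : Type) (r : seq J) (F : J -> R -> R[i]) :
  (forall j, L2 (F j)) -> (forall j, approximable (F j)) ->
  approximable (fun t => \sum_(j <- r) F j t).
Proof.
move=> FL FA; elim: r => [|j r IH].
  rewrite (_ : (fun t => _) = lincomb [::]); last first.
    by apply/funext => t; rewrite /lincomb !big_nil.
  exact: approximable_lincomb.
under eq_fun do rewrite big_cons.
by apply: approximableD => //; exact: L2_sum.
Qed.

Lemma approximable_closed f : L2 f ->
  (forall eps : R, 0 < eps -> exists g,
     [/\ L2 g, approximable g & nrm2 (fun t => f t - g t) < eps]) ->
  approximable f.
Proof.
move=> fL fA eps eps0.
have [g [gL gA fg]] := fA (eps / 4) ltac:(lra).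
have [ps psP] := gA (eps / 4) ltac:(lra).
exists ps.
rewrite (@eq_nrm2 _ _ (fun t => (f t - g t) + (g t - lincomb ps t))); last first.
  by move=> t; ring.
apply: le_lt_trans (nrm2D_le _ _) _.
- exact: L2B.
- by apply: L2B => //; exact: L2_lincomb.
- lra.
Qed.

Hypothesis eO : forall i j, L2dot (e i) (e j) = (i == j)%:R.

Definition proj s f (t : R) : R[i] := \sum_(i <- s) L2dot f (e i) * e i t.

Lemma L2_proj s f : L2 (proj s f).
Proof. by apply: L2_sum => i; exact: L2Z. Qed.

Lemma L2dot_proj s f j : uniq s ->
  L2dot (proj s f) (e j) = if j \in s then L2dot f (e j) else 0.
Proof.
move=> us; rewrite L2dot_suml//; last by move=> i; exact: L2Z.
under eq_bigr do rewrite L2dotZl// eO.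
case: ifPn => js.
  rewrite (bigD1_seq j)//= eqxx mulr1 big1 ?addr0// => i /negbTE ->; exact: mulr0.
rewrite big_seq big1// => i si; case: eqP => [ij|_]; last exact: mulr0.
by rewrite -ij si in js.
Qed.

(** Bessel's identity. The remainder after projecting on s still has coefficient [L2dot f (e i)] at
    a new index i, and removing that component lowers the squared norm by the squared modulus of the
    coefficient. *)
Lemma nrm2_proj s f : uniq s -> L2 f ->
  nrm2 (fun t => f t - proj s f t) = nrm2 f - \sum_(i <- s) nsq (L2dot f (e i)).
Proof.
move=> + fL; elim: s => [_|i s IH /= /andP[si us]].
  by rewrite big_nil subr0; apply: eq_nrm2 => t; rewrite /proj big_nil subr0.
rewrite big_cons.
rewrite (@eq_nrm2 _ _ (fun t => (f t - proj s f t) - L2dot f (e i) * e i t)); last first.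
  by move=> t; rewrite /proj big_cons; ring.
have hL : L2 (fun t => f t - proj s f t) by apply: L2B => //; exact: L2_proj.
rewrite nrm2B//; last exact: L2Z.
rewrite nrm2Z// L2dotZr// L2dotBl//; last exact: L2_proj.
rewrite L2dot_proj// (negbTE si) subr0 IH//.
have -> : nrm2 (e i) = 1.
  by have := L2dot_self (e i); rewrite eO eqxx => /(congr1 cRe)/=.
rewrite (mulrC (_^*%C)) mul_conjc/=.
ring.
Qed.

(** The remainder of the projection is orthogonal to every combination with indices in s, so by
    Pythagoras no such combination comes closer to f than the projection does. *)
Lemma lincomb_best s ps f : uniq s -> L2 f -> {subset [seq p.1 | p <- ps] <= s} ->
  nrm2 f - \sum_(i <- s) nsq (L2dot f (e i)) <= nrm2 (fun t => f t - lincomb ps t).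
Proof.
move=> us fL pss.
rewrite -nrm2_proj//.
rewrite [leRHS](@eq_nrm2 _ _
  (fun t => (f t - proj s f t) + (proj s f t - lincomb ps t))); last first.
  by move=> t; ring.
have hL : L2 (fun t => f t - proj s f t) by apply: L2B => //; exact: L2_proj.
have kL : L2 (fun t => proj s f t - lincomb ps t).
  by apply: L2B; [exact: L2_proj|exact: L2_lincomb].
have h0 j : j \in s -> L2dot (e j) (fun t => f t - proj s f t) = 0.
  move=> js; rewrite L2dotC// L2dotBl//; last exact: L2_proj.
  by rewrite L2dot_proj// js subrr rmorph0.
rewrite (nrm2D hL kL) (L2dotC kL hL) (_ : L2dot _ _ = 0); last first.
  rewrite L2dotBl//; [|exact: L2_proj|exact: L2_lincomb].
  rewrite !L2dot_suml//; [|by move=> ?; exact: L2Z..].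
  rewrite !big_seq !big1 ?subr0// => [p pps|i si].
    by rewrite L2dotZl// h0 ?mulr0//; apply: pss; exact: map_f.
  by rewrite L2dotZl// h0 ?mulr0.
by rewrite rmorph0 mulr0 addr0 lerDl nrm2_ge0.
Qed.

(** Finite partial sums are bounded by Bessel's identity. Conversely, the indices of a combination
    within eps of f carry all but eps of the squared norm, by [lincomb_best]. *)
Lemma approximable_parseval f : L2 f -> approximable f ->
  (\esum_(i in [set: I]) (nsq (L2dot f (e i)))%:E = (nrm2 f)%:E)%E.
Proof.
move=> fL fA; apply/eqP; rewrite eq_le; apply/andP; split.
  apply: ge_ereal_sup => _ [A [finA _] <-].
  rewrite fsbig_finite//= sumEFin lee_fin -subr_ge0 -nrm2_proj//; exact: nrm2_ge0.
apply/lee_addgt0Pr => eps eps0.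
have [ps psP] := fA eps eps0.
pose s := undup [seq p.1 | p <- ps].
have := @lincomb_best s ps f (undup_uniq _) fL.
move=> /(_ ltac:(by move=> i; rewrite mem_undup)) /le_lt_trans/(_ psP).
rewrite ltrBlDr -lte_fin => /ltW; move/le_trans; apply.
rewrite EFinD addeC leeD2r//; apply: esum_ge.
exists [set` s]; first by split => //; exact: finite_seq.
by rewrite -fsbig_seq ?undup_uniq// sumEFin.
Qed.

(** A finite partial sum that misses the total by less than eps gives a projection whose squared
    error is precisely what is missing. *)
Lemma parseval_proj f : L2 f ->
  (\esum_(i in [set: I]) (nsq (L2dot f (e i)))%:E = (nrm2 f)%:E)%E ->
  forall eps : R, 0 < eps -> exists s, nrm2 (fun t => f t - proj s f t) < eps.
Proof.
move=> fL fE eps eps0.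
have : ((nrm2 f - eps)%:E < \esum_(i in [set: I]) (nsq (L2dot f (e i)))%:E)%E.
  by rewrite fE lte_fin ltrBlDr ltrDl.
move=> /ereal_sup_gt[_ [A [finA _] <-]].
rewrite fsbig_finite//= sumEFin lte_fin => H.
exists (finmap.enum_fset (fset_set A)); rewrite nrm2_proj//.
lra.
Qed.

End Orthonormal.

(** * The exponentials exp(i x) *)

Section Cexpi.
Context {R : realType}.
Local Notation mu := (@lebesgue_measure R).
Local Notation TR := (measurableTypeR R).
Local Notation cRe := (@complex.Re R).
Implicit Types x y : R.

Lemma cexpiD x y : cexpi (x + y) = cexpi x * cexpi y.
Proof. by apply: complex_ext; rewrite !ReImE /= ?cosD ?sinD; ring. Qed.
Lemma cexpi0 : cexpi 0 = 1 :> R[i].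
Proof. by rewrite /cexpi cos0 sin0. Qed.
Lemma cexpi_conj x : (cexpi x)^*%C = cexpi (- x).
Proof. by rewrite /cexpi cosN sinN. Qed.
Lemma nsq_cexpi x : nsq (cexpi x) = 1.
Proof. by rewrite /nsq/= cos2Dsin2. Qed.
Lemma cexpi_pi_int (k : int) x : cexpi (x + 2 * k%:~R * pi) = cexpi x.
Proof.
suff n (m : nat) y : cexpi (y + 2 * m%:R * pi) = cexpi y.
  case: k => k; first exact: n.
  by rewrite -[LHS](n k.+1); congr cexpi; rewrite NegzE mulrNz; ring.
have -> : (2 : R) * m%:R * pi = pi *+ 2 *+ m by rewrite -mulr_natr -[pi *+ 2]mulr_natr; ring.
by rewrite /cexpi (periodicn (@cosD2pi R)) (periodicn (@sinD2pi R)).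
Qed.

Lemma measurable_cos_comp (h : R -> R) : measurable_fun [set: TR] h ->
  measurable_fun [set: TR] (cos \o h).
Proof.
by move=> mh; apply: measurableT_comp mh; apply: continuous_measurable_fun; exact: continuous_cos.
Qed.
Lemma measurable_sin_comp (h : R -> R) : measurable_fun [set: TR] h ->
  measurable_fun [set: TR] (sin \o h).
Proof.
by move=> mh; apply: measurableT_comp mh; apply: continuous_measurable_fun; exact: continuous_sin.
Qed.
Lemma cmeas_cexpi (h : R -> R) : measurable_fun [set: TR] h -> cmeas (fun t => cexpi (h t)).
Proof. by move=> mh; split; [exact: measurable_cos_comp|exact: measurable_sin_comp]. Qed.

Lemma measurable_mull (c : R) : measurable_fun [set: TR] (fun t : R => c * t).
Proof. exact: mulrl_measurable. Qed.

End Cexpi.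
Arguments cexpi_pi_int {R} k x.

(** * Dominated convergence in L2 *)

Section DominatedL2.
Context {R : realType}.
Local Notation mu := (@lebesgue_measure R).
Local Notation TR := (measurableTypeR R).

(** Only one good index is extracted from the convergence, which is all that approximation arguments
    such as [approximable_closed] ask for. *)
Lemma nrm2_dominated (F : nat -> R -> R[i]) (f : R -> R[i]) (h : R -> R) :
  (forall n, cmeas (F n)) -> cmeas f -> rint h ->
  (forall n t, nsq (f t - F n t) <= h t) ->
  {ae mu, forall t, (fun n => nsq (f t - F n t)) @ \oo --> (0 : R)} ->
  forall eps : R, 0 < eps -> exists n, nrm2 (fun t => f t - F n t) < eps.
Proof.
move=> mF mf ih dom cv eps eps0.
have mfF n : cmeas (fun t => f t - F n t).
  apply: cmeasD => //; apply: (eq_cmeas _ (cmeasZ (-1) (mF n))) => t.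
  by rewrite mulN1r.
have ifF n : rint (fun t => nsq (f t - F n t)).
  apply: le_rint ih; first exact: (measurable_nsq (mfF n)).
  by move=> t; rewrite ger0_norm ?nsq_ge0.
have [] := @dominated_convergence _ TR R mu setT measurableT
  (fun n t => (nsq (f t - F n t))%:E) (cst 0%E) (EFin \o h).
- by move=> n; apply/measurable_EFinP; exact: (measurable_nsq (mfF n)).
- exact: measurable_cst.
- case: cv => N [mN N0 sub]; exists N; split => //; apply: subset_trans sub.
  by move=> t /= + cvt; apply => _; apply/cvg_EFin => //; exact: nearW.
- exact: ih.
- by apply: aeW => t n _; rewrite lee_fin ger0_norm ?nsq_ge0.
move=> _ _; rewrite integral0 => cvI.
have := cvI [set x | (x < eps%:E)%E].
have nb : nbhs (0 : \bar R)%E [set x | (x < eps%:E)%E].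
  by apply: open_nbhs_nbhs; split; [exact: open_ereal_lt_ereal|rewrite /= lte_fin].
move=> /(_ nb) [N _ /(_ N (leqnn N))]/= HN; exists N.
by rewrite -lte_fin Rint_EFin.
Qed.

End DominatedL2.

(** * Polynomials converging to a step function *)

Section StepApproximation.
Context {R : realType}.

Lemma exprn_cvg0 (z : R) : 0 <= z < 1 -> (fun n => z ^+ n) @ \oo --> (0 : R).
Proof. by move=> /andP[z0 z1]; apply: cvg_expr; rewrite ger0_norm. Qed.

Lemma bernoulli_ineq (y : R) n : 0 <= y <= 1 -> 1 - n%:R * y <= (1 - y) ^+ n.
Proof.
move=> /andP[y0 y1]; elim: n => [|n IH]; first by rewrite mul0r subr0 expr0.
rewrite exprS; have y2 : 0 <= 1 - y by lra.
apply: le_trans (ler_wpM2l y2 IH); rewrite -natr1.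
have : 0 <= n%:R * (y * y) by rewrite mulr_ge0// mulr_ge0.
lra.
Qed.

Lemma bernoulli_ineq2 (y : R) n : 0 <= y -> 1 + n%:R * y <= (1 + y) ^+ n.
Proof.
move=> y0; elim: n => [|n IH]; first by rewrite mul0r addr0 expr0.
rewrite exprS; have y2 : 0 <= 1 + y by lra.
apply: le_trans (ler_wpM2l y2 IH); rewrite -natr1.
have : 0 <= n%:R * (y * y) by rewrite mulr_ge0// mulr_ge0.
lra.
Qed.

(* The step functions of Brosowski and Deutsch, with the jump at 1/2. *)
Definition unitstep n (x : R) : R := (1 - x ^+ n) ^+ (2 ^ n).

Lemma unitstep_itv n (x : R) : 0 <= x <= 1 -> 0 <= unitstep n x <= 1.
Proof.
move=> /andP[x0 x1]; have y0 : 0 <= x ^+ n by rewrite exprn_ge0.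
have y1 : x ^+ n <= 1 by rewrite exprn_ile1.
by rewrite exprn_ge0 ?subr_ge0//= exprn_ile1 ?subr_ge0// gerBl.
Qed.

(** Bernoulli's inequality bounds the value below by 1 - 2^n x^n = 1 - (2 x)^n, and 2 x < 1. *)
Lemma unitstep_cvg1 (x : R) : 0 <= x < 1 / 2 -> (fun n => unitstep n x) @ \oo --> (1 : R).
Proof.
move=> /andP[x0 x1].
apply: (@squeeze_cvgr _ _ _ _ (fun n => 1 - (2 * x) ^+ n) (fun=> 1)).
- apply: nearW => n; have /andP[_ ->] := @unitstep_itv n x ltac:(lra).
  rewrite andbT /unitstep exprMn -natrX; apply: bernoulli_ineq.
  by rewrite exprn_ge0//= exprn_ile1//; lra.
- rewrite -[X in _ --> X]subr0; apply: cvgB; first exact: cvg_cst.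
  by apply: exprn_cvg0; lra.
- exact: cvg_cst.
Qed.

(** With y = x^n, the product of (1 - y)^(2^n) and (1 + y)^(2^n) is at most 1, while the second
    factor is at least 2^n y = (2 x)^n by Bernoulli; hence the bound (2 x)^(- n), with 2 x > 1. *)
Lemma unitstep_cvg0 (x : R) : 1 / 2 < x <= 1 -> (fun n => unitstep n x) @ \oo --> (0 : R).
Proof.
move=> /andP[x0 x1].
apply: (@squeeze_cvgr _ _ _ _ (fun=> 0) (fun n => (2 * x)^-1 ^+ n)).
- apply: nearW => n; have /andP[-> _]/= := @unitstep_itv n x ltac:(lra).
  set y := x ^+ n.
  have y0 : 0 <= y by rewrite exprn_ge0//; lra.
  have y1 : y <= 1 by rewrite exprn_ile1//; lra.
  rewrite exprVn -[leRHS]mul1r ler_pdivlMr ?exprn_gt0//; last lra.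
  apply: (@le_trans _ _ (unitstep n x * (1 + y) ^+ (2 ^ n))).
    apply: ler_wpM2l; first by have /andP[] := @unitstep_itv n x ltac:(lra).
    apply: le_trans (bernoulli_ineq2 _ y0).
    by rewrite exprMn -natrX ler_wpDl.
  rewrite /unitstep -exprMn exprn_ile1//.
    by rewrite mulr_ge0 ?subr_ge0// addr_ge0.
  have : 0 <= y * y by rewrite mulr_ge0.
  rewrite -/y; lra.
- exact: cvg_cst.
- apply: exprn_cvg0; rewrite invr_ge0 invf_lt1; lra.
Qed.

End StepApproximation.

(** * The trigonometric system *)

Section TrigSystem.
Context {R : realType}.
Local Notation mu := (@lebesgue_measure R).
Local Notation TR := (measurableTypeR R).
Local Notation cRe := (@complex.Re R).
Local Notation cIm := (@complex.Im R).

(** Half-open, so that its translates by multiples of 2 pi partition the line exactly. *)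
Definition circle : set R := `[- pi, pi[%classic.

Lemma measurable_circle : measurable (circle : set TR).
Proof. exact: measurable_itv. Qed.

Lemma lt_Npi_pi : - pi < pi :> R.
Proof. by have := @pi_gt0 R; lra. Qed.

Lemma mu_circle : mu circle = (2 * pi)%:E.
Proof.
rewrite /circle lebesgue_measure_itv/= lte_fin lt_Npi_pi -EFinD; congr EFin; ring.
Qed.

Lemma cmeas_indic (A : set R) : measurable (A : set TR) -> cmeas (fun t => (\1_A t)%:C).
Proof. by move=> mA; apply: cmeas_real; exact: measurable_indic. Qed.

Lemma indic_itv01 (A : set R) (t : R) : 0 <= (\1_A t : R) <= 1.
Proof. by rewrite indicE; case: (_ \in _); rewrite ?lexx ?ler01. Qed.

Lemma rint_indic (A : set R) : measurable (A : set TR) -> (mu A < +oo)%E -> rint (\1_A : R -> R).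
Proof.
move=> mA Aoo; apply: rint_lty; first exact: measurable_indic.
  by move=> t; case/andP: (indic_itv01 A t).
by rewrite integral_indic// setIT.
Qed.

Lemma rint_circle : rint (\1_circle : R -> R).
Proof. by apply: rint_indic; [exact: measurable_circle|rewrite mu_circle ltry]. Qed.

Lemma Rint_indic (A : set R) : measurable (A : set TR) -> (mu A < +oo)%E ->
  \int[mu]_t (\1_A t : R) = fine (mu A).
Proof. by move=> mA Aoo; rewrite /Rintegral integral_indic// setIT. Qed.

Lemma nsq_indicM (A : set R) (z : R[i]) t : nsq ((\1_A t)%:C * z) = \1_A t * nsq z.
Proof.
rewrite nsqM nsq_real indicE; case: (_ \in _); by rewrite ?expr1n ?expr0n ?mul0r.
Qed.

(** The fundamental theorem of calculus on [- pi, pi]; the endpoint missing from [circle] does not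
    affect the integral. *)
Lemma Rint_circle_derive (f F : R -> R) : continuous f ->
  (forall t : R, is_derive t 1 F (f t)) -> F pi = F (- pi) ->
  \int[mu]_t (\1_circle t * f t) = 0.
Proof.
move=> cf dF FE.
have -> : \int[mu]_t (\1_circle t * f t) = \int[mu]_(t in circle) f t.
  rewrite [RHS]Rintegral_mkcond; apply: eq_Rintegral => t _.
  by rewrite patchE indicE; case: (_ \in _); rewrite ?mul1r ?mul0r.
have ci : {within `[- pi, pi], continuous f} by exact: continuous_subspaceT.
rewrite /circle Rintegral_itv_bndo_bndc; last first.
  apply: (@integrableS _ _ _ mu `[- pi, pi]%classic) => //.
    by apply: subset_itvl; rewrite bnd_simp.
  by apply: continuous_compact_integrable => //; exact: segment_compact.
have cF (t : R) : {for t, continuous F}.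
  by apply: differentiable_continuous; apply/derivable1_diffP; exact: ex_derive.
rewrite /Rintegral (@continuous_FTC2 _ _ F)//=.
- by rewrite FE subrr.
- exact: lt_Npi_pi.
- split.
  + by move=> t _; exact: ex_derive.
  + by apply: cvg_at_right_filter; exact: cF.
  + by apply: cvg_at_left_filter; exact: cF.
- by move=> t _; rewrite derive1E; exact: derive_val.
Qed.

Lemma continuous_mul_comp (m : R) (g : R -> R) : continuous g -> continuous (fun t => g (m * t)).
Proof.
move=> cg t; apply: (@continuous_comp _ _ _ (fun t : R => m * t) g); last exact: cg.
exact: mulrl_continuous.
Qed.

Lemma Rint_circle_cos (m : R) : m != 0 -> sin (m * pi) = 0 ->
  \int[mu]_t (\1_circle t * cos (m * t)) = 0.
Proof.
move=> m0 sm; apply: (@Rint_circle_derive _ (fun t => m^-1 * sin (m * t))).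
- by apply: continuous_mul_comp; exact: continuous_cos.
- move=> t; apply: is_derive_eq; rewrite /GRing.scale/=; field; exact: m0.
- by rewrite mulrN sinN sm oppr0.
Qed.

Lemma Rint_circle_sin (m : R) : m != 0 ->
  \int[mu]_t (\1_circle t * sin (m * t)) = 0.
Proof.
move=> m0; apply: (@Rint_circle_derive _ (fun t => - m^-1 * cos (m * t))).
- by apply: continuous_mul_comp; exact: continuous_sin.
- move=> t; apply: is_derive_eq; rewrite /GRing.scale/=; field; exact: m0.
- by rewrite mulrN cosN.
Qed.

(** The normalized exponentials, extended by zero to the whole line so that the results on
    orthonormal families over the line apply to them. *)
Definition trig (k : int) (t : R) : R[i] :=
  (\1_circle t)%:C * ((Num.sqrt (2 * pi))^-1)%:C * cexpi (k%:~R * t).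

Lemma two_pi_gt0 : 0 < 2 * pi :> R. Proof. by rewrite mulr_gt0// pi_gt0. Qed.

Lemma cint_indic_cexpi (A : set R) (h : R -> R) : measurable (A : set TR) -> (mu A < +oo)%E ->
  measurable_fun [set: TR] h -> cint (fun t => (\1_A t)%:C * cexpi (h t)).
Proof.
move=> mA Aoo mh; apply: (@le_cint _ _ (\1_A : R -> R)).
- by apply: cmeasM; [exact: cmeas_indic|exact: cmeas_cexpi].
- move=> t; rewrite !ReImE/= mul0r subr0 normrM; have /andP[? ?] := indic_itv01 A t.
  by rewrite ger0_norm// ler_piMr// cos_max.
- move=> t; rewrite !ReImE/= mul0r addr0 normrM; have /andP[? ?] := indic_itv01 A t.
  by rewrite ger0_norm// ler_piMr// sin_max.
- exact: rint_indic.
Qed.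

Lemma sin_int_pi (k : int) : sin (k%:~R * pi) = 0 :> R.
Proof.
suff n (m : nat) : sin (m%:R * pi) = 0 :> R.
  case: k => k; first exact: n.
  by rewrite NegzE mulrNz mulNr sinN [X in - X](n k.+1) oppr0.
elim: m => [|m IH]; first by rewrite mul0r sin0.
by rewrite -natr1 mulrDl mul1r sinDpi IH oppr0.
Qed.

Lemma cintegral_circle_cexpi (k : int) :
  cintegral (fun t => (\1_circle t)%:C * cexpi (k%:~R * t)) = (2 * pi * (k == 0)%:R)%:C :> R[i].
Proof.
have mc := measurable_circle.
have [->|k0] := eqVneq k 0.
  rewrite /cintegral mulr1; apply: complex_ext => /=.
    under eq_Rintegral do rewrite !mul0r cos0 subr0 mulr1.
    by rewrite Rint_indic ?mu_circle// ltry.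
  under eq_Rintegral do rewrite !mul0r sin0 addr0 mulr0.
  by rewrite Rintegral_cst// mul0r.
have k0' : k%:~R != 0 :> R by rewrite intr_eq0.
rewrite mulr0 /cintegral; apply: complex_ext => /=.
  under eq_Rintegral do rewrite mul0r subr0.
  by rewrite Rint_circle_cos// sin_int_pi.
under eq_Rintegral do rewrite mul0r addr0.
by rewrite Rint_circle_sin.
Qed.

Lemma cmeas_trig k : cmeas (trig k).
Proof.
apply: cmeasM; last by apply: cmeas_cexpi; exact: measurable_mull.
by apply: cmeasM; [apply: cmeas_indic; exact: measurable_circle|exact: cmeas_cst].
Qed.

Lemma nsq_sqrt_two_pi : nsq ((Num.sqrt (2 * pi))^-1)%:C = (2 * pi)^-1 :> R.
Proof. by rewrite nsq_real exprVn sqr_sqrtr// ltW// two_pi_gt0. Qed.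

Lemma L2_trig k : L2 (trig k).
Proof.
apply: (@L2_le _ _ (fun t => (2 * pi)^-1 * \1_circle t)); first exact: cmeas_trig.
- by move=> t; rewrite /trig -mulrA nsq_indicM nsqM nsq_cexpi mulr1 nsq_sqrt_two_pi mulrC.
- by apply: rintZ; exact: rint_circle.
Qed.

Lemma trig_orthonormal k l : L2dot (trig k) (trig l) = (k == l)%:R.
Proof.
rewrite /L2dot (@eq_cintegral _ _
  (fun t => ((2 * pi)^-1)%:C * ((\1_circle t)%:C * cexpi ((k - l)%:~R * t)))); last first.
  move=> t; rewrite intrB mulrBl cexpiD -cexpi_conj -nsq_sqrt_two_pi -mul_conjc /trig.
  apply: complex_ext; rewrite !ReImE/= indicE; case: (_ \in _); rewrite ?mul0r/=; ring.
rewrite cintegralZ; last first.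
  apply: cint_indic_cexpi; [exact: measurable_circle|by rewrite mu_circle ltry|].
  exact: measurable_mull.
rewrite cintegral_circle_cexpi subr_eq0 -rmorphM mulrA mulVf; last by rewrite gt_eqF// two_pi_gt0.
by rewrite mul1r rmorph_nat.
Qed.

End TrigSystem.

(** * Completeness of the trigonometric system *)

Section TrigComplete.
Context {R : realType}.
Local Notation mu := (@lebesgue_measure R).
Local Notation TR := (measurableTypeR R).
Local Notation cRe := (@complex.Re R).
Local Notation cIm := (@complex.Im R).

(** Without the cutoff to [circle], these functions form an algebra containing the constants, so
    polynomials such as [unitstep] may be applied to them. *)
Definition trigpoly (p : R -> R[i]) :=
  exists ps : seq (int * R[i]), forall t, p t = \sum_(q <- ps) q.2 * cexpi (q.1%:~R * t).

Lemma eq_trigpoly p q : p =1 q -> trigpoly p -> trigpoly q. Proof. by move/funext => ->. Qed.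

Lemma trigpoly_cexpi c (k : int) : trigpoly (fun t => c * cexpi (k%:~R * t)).
Proof. by exists [:: (k, c)] => t; rewrite big_seq1. Qed.

Lemma trigpoly_cst c : trigpoly (fun=> c).
Proof.
by apply: (eq_trigpoly _ (trigpoly_cexpi c 0)) => t; rewrite mul0r cexpi0 mulr1.
Qed.

Lemma trigpolyD p q : trigpoly p -> trigpoly q -> trigpoly (fun t => p t + q t).
Proof.
by move=> [ps pE] [qs qE]; exists (ps ++ qs) => t; rewrite pE qE big_cat.
Qed.

Lemma trigpolyM p q : trigpoly p -> trigpoly q -> trigpoly (fun t => p t * q t).
Proof.
move=> [ps pE] [qs qE]; exists [seq (x.1 + y.1, x.2 * y.2) | x <- ps, y <- qs] => t.
rewrite pE qE big_distrl/= big_allpairs_dep/=; apply: eq_bigr => x _.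
rewrite big_distrr/=; apply: eq_bigr => y _.
by rewrite intrD mulrDl cexpiD; ring.
Qed.

Lemma trigpolyX p n : trigpoly p -> trigpoly (fun t => p t ^+ n).
Proof.
move=> pT; elim: n => [|n IH].
  by apply: (eq_trigpoly _ (trigpoly_cst 1)) => t; rewrite expr0.
by apply: (eq_trigpoly _ (trigpolyM pT IH)) => t; rewrite exprS.
Qed.

Lemma trigpoly_cos (c : R) : trigpoly (fun t => (cos (t - c))%:C).
Proof.
apply: (eq_trigpoly _ (trigpolyD (trigpoly_cexpi ((2^-1)%:C * cexpi (- c)) 1)
                                 (trigpoly_cexpi ((2^-1)%:C * cexpi c) (-1)))) => t.
rewrite -!mulrA -!cexpiD mul1r mulN1r (_ : c - t = - (t - c)); last by ring.
rewrite (_ : - c + t = t - c); last by ring.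
by rewrite -cexpi_conj; apply: complex_ext; rewrite !ReImE/=; field.
Qed.

Lemma approximable_trigpoly p : trigpoly p -> approximable trig (fun t => (\1_circle t)%:C * p t).
Proof.
move=> [ps pE].
have s0 : Num.sqrt (2 * pi) != 0 :> R by rewrite gt_eqF// sqrtr_gt0 two_pi_gt0.
rewrite (_ : (fun t => _) = lincomb trig [seq (q.1, q.2 * (Num.sqrt (2 * pi))%:C) | q <- ps]).
  exact: approximable_lincomb.
apply/funext => t; rewrite pE /lincomb big_map big_distrr/=; apply: eq_bigr => q _.
rewrite /trig.
have : (Num.sqrt (2 * pi))%:C * ((Num.sqrt (2 * pi))^-1)%:C = 1 :> R[i].
  by rewrite -rmorphM mulfV.
move: (_%:C) (_%:C) => a b ab; rewrite -[LHS]mul1r -ab; ring.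
Qed.

Lemma L2_indic_circle (A : set R) : measurable (A : set TR) ->
  L2 (fun t => (\1_circle t)%:C * (\1_A t)%:C).
Proof.
move=> mA; apply: (@L2_le _ _ (\1_circle : R -> R)).
- by apply: cmeasM; apply: cmeas_indic => //; exact: measurable_circle.
- move=> t; rewrite nsq_indicM nsq_real.
  have /andP[? ?] := indic_itv01 circle t; have /andP[? ?] := indic_itv01 A t.
  by rewrite ler_piMr// exprn_ile1.
- exact: rint_circle.
Qed.

(* For t in (- pi, pi), the second factor has the sign of [b - t] and the first is positive. *)
Definition ray_arg (b t : R) : R := 1 / 2 + 1 / 2 * (cos (t / 2) * sin ((b - t) / 2)).

(** In the product-to-sum formula for cos v sin u, the sum u + v is b / 2 and the difference u - v
    is b / 2 - t. The half angles in t thus disappear, leaving a constant plus a quarter of a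
    shifted cosine of t. *)
Lemma trigpoly_ray_arg b : trigpoly (fun t => (ray_arg b t)%:C).
Proof.
pose k : R := 1 / 2 + 1 / 4 * sin (b / 2).
apply: (eq_trigpoly _ (trigpolyD (trigpoly_cst k%:C)
  (trigpolyM (trigpoly_cst (1 / 4)%:C) (trigpoly_cos (b / 2 - pi / 2))))) => t.
rewrite -rmorphM -rmorphD; congr (_%:C); rewrite /ray_arg /k.
pose u := (b - t) / 2; pose v := t / 2; rewrite -/u -/v.
rewrite (_ : t - (b / 2 - pi / 2) = (- u + v) + pi / 2); last by rewrite /u /v; field.
rewrite cosDpihalf (_ : b / 2 = u + v); last by rewrite /u /v; field.
by rewrite !sinD cosN sinN; field.
Qed.

Lemma ray_arg_itv b t : 0 <= ray_arg b t <= 1.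
Proof.
have := cos_max (t / 2); have := sin_max ((b - t) / 2).
rewrite /ray_arg; set x := cos _; set y := sin _ => hy hx.
have : `|x * y| <= 1 by rewrite normrM mulr_ile1.
rewrite ler_norml => /andP[? ?]; lra.
Qed.

Lemma ray_arg_lt b t : - pi < t < pi -> - pi < b <= pi -> t < b -> 1 / 2 < ray_arg b t.
Proof.
move=> ht hb tb; rewrite /ray_arg ltrDl mulr_gt0// mulr_gt0//.
  by apply: cos_gt0_pihalf; lra.
by apply: sin_gt0_pi; lra.
Qed.

Lemma ray_arg_gt b t : - pi < t < pi -> - pi < b <= pi -> b < t -> ray_arg b t < 1 / 2.
Proof.
move=> ht hb tb; rewrite /ray_arg gtrDl pmulr_rlt0// pmulr_rlt0//.
  rewrite (_ : (b - t) / 2 = - ((t - b) / 2)); last by ring.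
  by rewrite sinN oppr_lt0; apply: sin_gt0_pi; lra.
by apply: cos_gt0_pihalf; lra.
Qed.

Lemma circleE (t : R) : circle t -> - pi <= t < pi.
Proof. by rewrite /circle/= in_itv/=. Qed.

(** The trigonometric polynomials [1 - unitstep n (ray_arg b t)] tend to 1 where [ray_arg] exceeds
    1/2, that is for t < b, and to 0 for t > b. *)
Lemma approximable_ray0 (b : R) : - pi < b <= pi -> approximable trig
  (fun t => (\1_circle t)%:C * (\1_`]-oo, b[%classic t)%:C).
Proof.
move=> hb.
have mci := @measurable_circle R.
have mray : measurable (`]-oo, b[%classic : set TR) by exact: measurable_itv.
apply: (approximable_closed (@L2_trig R) (L2_indic_circle mray)) => eps eps0.
pose F n t : R[i] := (\1_circle t)%:C * (1 - unitstep n (ray_arg b t))%:C.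
have FT n : trigpoly (fun t => (1 - unitstep n (ray_arg b t))%:C).
  have T1 := trigpolyM (trigpoly_cst (-1)) (trigpolyX n (trigpoly_ray_arg b)).
  have T2 := trigpolyX (2 ^ n) (trigpolyD (trigpoly_cst 1) T1).
  apply: (eq_trigpoly _ (trigpolyD (trigpoly_cst 1) (trigpolyM (trigpoly_cst (-1)) T2))) => t.
  by rewrite !mulN1r /unitstep rmorphB/= rmorphXn/= rmorphB/= rmorphXn/=.
have mF n : cmeas (F n).
  apply: cmeasM; first exact: cmeas_indic.
  have [ps /funext ->] := FT n; apply: cmeas_sum => q; apply: cmeasZ.
  by apply: cmeas_cexpi; exact: measurable_mull.
have FB n t : nsq ((\1_circle t)%:C * (\1_`]-oo, b[%classic t)%:C - F n t) =
    \1_circle t * (\1_`]-oo, b[%classic t - 1 + unitstep n (ray_arg b t)) ^+ 2.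
  rewrite -mulrBr nsq_indicM -rmorphB nsq_real; congr (_ * _ ^+ 2); ring.
have dom n t : nsq ((\1_circle t)%:C * (\1_`]-oo, b[%classic t)%:C - F n t) <= \1_circle t.
  rewrite FB; have /andP[? ?] := indic_itv01 circle t.
  have /andP[u0 u1] := unitstep_itv n (ray_arg_itv b t).
  have uu : 0 <= unitstep n (ray_arg b t) * (1 - unitstep n (ray_arg b t)).
    by rewrite mulr_ge0// subr_ge0.
  rewrite ler_piMr// expr2 indicE; case: (_ \in _); rewrite ?mulr1n ?mulr0n; nra.
have [|n Hn] := nrm2_dominated mF (cmeasM (cmeas_indic mci) (cmeas_indic mray))
  (@rint_circle R) dom _ eps0.
  (* At both points [ray_arg b] equals 1/2, where neither limit of [unitstep] is available; the
     cosine factor vanishes at - pi and the sine factor at b. *)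
  exists ([set - pi] `|` [set b]); split.
  - exact: measurableU.
  - by apply: null_set_setU => //; exact: lebesgue_measure_set1.
  - move=> t; apply: contra_notP => /not_orP[/eqP tNpi /eqP tb] /=.
    under eq_fun do rewrite FB.
    rewrite indicE; case: (boolP (t \in circle)) => tc; last first.
      by under eq_fun do rewrite mul0r; exact: cvg_cst.
    under eq_fun do rewrite mul1r.
    have /circleE/andP[t1 t2] : circle t by rewrite inE in tc.
    have t3 : - pi < t < pi by rewrite lt_neqAle eq_sym tNpi t1 t2.
    suff c0 : (fun n => \1_`]-oo, b[%classic t - 1 + unitstep n (ray_arg b t)) @ \oo --> (0 : R).
      under eq_fun do rewrite expr2.
      by have := cvgM c0 c0; rewrite mulr0; exact.
    rewrite indicE; case: ltgtP tb => // tb _.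
    + rewrite mem_set /=; last by rewrite in_itv.
      under eq_fun do rewrite subrr add0r; apply: unitstep_cvg0.
      by rewrite ray_arg_lt//; case/andP: (ray_arg_itv b t).
    + rewrite memNset /=; last by rewrite in_itv/= => /lt_trans/(_ tb); rewrite ltxx.
      rewrite -[X in _ --> X](addNr (1 : R)); under eq_fun do rewrite sub0r.
      apply: cvgD; first exact: cvg_cst.
      apply: unitstep_cvg1; rewrite ray_arg_gt// andbT.
      by case/andP: (ray_arg_itv b t).
exists (F n); split => //; last exact: approximable_trigpoly.
apply: (@L2_le _ _ (\1_circle : R -> R)) => //; last exact: rint_circle.
move=> t; rewrite nsq_indicM nsq_real; have /andP[? ?] := indic_itv01 circle t.
have := unitstep_itv n (ray_arg_itv b t) => ?.
by rewrite ler_piMr// exprn_ile1//; lra.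
Qed.

Lemma approximable_indic0 : approximable (@trig R) (fun=> 0).
Proof.
rewrite (_ : (fun=> 0) = lincomb (@trig R) [::]); first exact: approximable_lincomb.
by apply/funext => t; rewrite /lincomb big_nil.
Qed.

Lemma approximable_ray (b : R) : approximable trig
  (fun t => (\1_circle t)%:C * (\1_`]-oo, b[%classic t)%:C).
Proof.
have [bNpi|bNpi] := leP b (- pi).
  rewrite (_ : (fun t => _) = (fun=> 0)); first exact: approximable_indic0.
  apply/funext => t; rewrite !indicE; case: (boolP (t \in circle)) => tc; last by rewrite mul0r.
  rewrite memNset ?mulr0//= in_itv/=.
  by move: tc; rewrite inE => /circleE/andP[t1 t2]; apply/negP; rewrite -leNgt (le_trans bNpi).
have [bpi|bpi] := leP b pi; first by apply: approximable_ray0; rewrite bNpi.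
have := @approximable_ray0 pi; rewrite lt_Npi_pi lexx => /(_ isT).
congr approximable; apply/funext => t; rewrite !indicE.
case: (boolP (t \in circle)) => tc; last by rewrite !mul0r.
move: tc; rewrite inE => /circleE/andP[t1 t2].
by rewrite !mem_set//= in_itv//= (lt_trans t2).
Qed.

(** Dynkin's pi-lambda theorem: open rays are stable under intersection and generate the Borel sets,
    and the sets with approximable indicator are stable under complement and, by dominated
    convergence, under countable disjoint union. *)
Lemma approximable_measurable (A : set R) : measurable (A : set TR) ->
  approximable trig (fun t => (\1_circle t)%:C * (\1_A t)%:C).
Proof.
have mci := @measurable_circle R.
pose P (A : set TR) := approximable trig (fun t => (\1_circle t)%:C * (\1_A t)%:C).
have E := congr1 (fun X : set (set R) => X A) (RGenInftyO.measurableE R).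
move=> mA; have : <<s (@RGenInftyO.G R) >> A.
  by change ((@RGenInftyO.G R).-sigma.-measurable A); rewrite -E; exact: mA.
apply: (@dynkin_induction _ TR (@RGenInftyO.G R) P).
- exact: RGenInftyO.measurableE.
- move=> _ _ [x ->] [y ->]; exists (Num.min x y).
  by apply/seteqP; split => t /=; rewrite !in_itv/= lt_min => /andP.
- by rewrite /P indicT; apply: approximable_trigpoly; exact: (trigpoly_cst 1%:C).
- by move=> _ [x ->]; exact: approximable_ray.
- move=> S mS PS; rewrite /P.
  rewrite (_ : (fun t => _) = fun t => (\1_circle t)%:C * 1 +
     -1 * ((\1_circle t)%:C * (\1_S t)%:C)); last first.
    apply/funext => t; rewrite !indicE in_setC.
    by case: (_ \in S) => /=; rewrite ?(mulr0, mulr1, mulrN1, addrN, addr0)//; ring.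
  apply: approximableD.
  + exact: L2_trig.
  + by have := L2_indic_circle (@measurableT _ TR); rewrite indicT.
  + by apply: L2Z; exact: L2_indic_circle.
  + by apply: approximable_trigpoly; exact: trigpoly_cst.
  + by apply: approximableZ => //; [exact: L2_trig|exact: L2_indic_circle].
- move=> F mF tF PF; rewrite /P.
  have mU n : measurable (\big[setU/set0]_(i < n) F i : set TR) by exact: bigsetU_measurable.
  have mUoo : measurable (\bigcup_k F k : set TR) by exact: bigcupT_measurable.
  have PU n : P (\big[setU/set0]_(i < n) F i).
    elim: n => [|n IH].
      rewrite big_ord0 /P; under eq_fun do rewrite indic0 mulr0.
      exact: approximable_indic0.
    rewrite big_ord_recr /P (_ : (fun t => _) = fun t =>
      (\1_circle t)%:C * (\1_(\big[setU/set0]_(i < n) F i) t)%:C +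
      (\1_circle t)%:C * (\1_(F n) t)%:C); last first.
      apply/funext => t; rewrite -mulrDr -rmorphD; congr (_ * _%:C).
      rewrite !indicE in_setU; case: (boolP (t \in F n)) => tFn; last by rewrite orbF addr0.
      rewrite orbT memNset ?add0r// -bigcup_mkord => -[k /= kn Fk].
      move: tFn; rewrite inE => tFn.
      have kE : k = n by apply: tF => //; exists t.
      by rewrite kE ltnn in kn.
    apply: approximableD; [exact: L2_trig|exact: L2_indic_circle..|exact: IH|exact: PF].
  apply: (approximable_closed (@L2_trig R) (L2_indic_circle mUoo)) => eps eps0.
  pose G n t : R[i] := (\1_circle t)%:C * (\1_(\big[setU/set0]_(i < n) F i) t)%:C.
  have GE n t : nsq ((\1_circle t)%:C * (\1_(\bigcup_k F k) t)%:C - G n t) =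
     \1_circle t * (\1_(\bigcup_k F k) t - \1_(\big[setU/set0]_(i < n) F i) t) ^+ 2.
    by rewrite -mulrBr nsq_indicM -rmorphB nsq_real.
  have [||n Hn] := @nrm2_dominated _ G _ _ (fun n => cmeasM (cmeas_indic mci) (cmeas_indic (mU n)))
    (cmeasM (cmeas_indic mci) (cmeas_indic mUoo)) (@rint_circle R) _ _ _ eps0.
  + move=> n t; rewrite GE; have /andP[? ?] := indic_itv01 circle t.
    rewrite ler_piMr// !indicE; case: (_ \in _); case: (_ \in _);
      by rewrite ?mulr1n ?mulr0n ?subrr ?subr0 ?sub0r ?sqrrN ?expr1n ?expr0n.
  + apply: aeW => t; under eq_fun do rewrite GE.
    suff [N HN] : exists N, forall n, (N <= n)%N ->
        \1_(\big[setU/set0]_(i < n) F i) t = \1_(\bigcup_k F k) t :> R.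
      apply: cvg_near_cst; exists N => // n /= /HN ->.
      by rewrite subrr expr0n/= mulr0.
    have [[k _ Fk]|nF] := pselect ((\bigcup_k F k) t).
      exists k.+1 => n kn; rewrite !indicE !mem_set//; first by exists k.
      by rewrite -bigcup_mkord; exists k.
    exists 0 => n _; rewrite !indicE !memNset// -bigcup_mkord => -[k _ Fk].
    by apply: nF; exists k.
  by exists (G n); split => //; [exact: L2_indic_circle|exact: PU].
Qed.

Lemma L2_circle_mul (f : R -> R[i]) : L2 f -> L2 (fun t => (\1_circle t)%:C * f t).
Proof.
apply: (@L2_bounded_mul _ _ _ 1).
- by apply: cmeas_indic; exact: measurable_circle.
- move=> t; rewrite nsq_real; have /andP[? ?] := indic_itv01 circle t.
  by rewrite exprn_ile1.
Qed.

Import HBNNSimple.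

(** Simple functions increasing to g have a squared error dominated by g^2, and each of them is a
    finite combination of indicators. *)
Lemma approximable_nonneg (g : R -> R) : (forall t, 0 <= g t) ->
  L2 (fun t => (g t)%:C) -> approximable trig (fun t => (\1_circle t)%:C * (g t)%:C).
Proof.
move=> g0 gL.
have mci := @measurable_circle R.
have mg : measurable_fun [set: TR] g by case: (L2_cmeas gL).
have mg' : measurable_fun [set: TR] (EFin \o g) by exact/measurable_EFinP.
pose h := nnsfun_approx (@measurableT _ TR) mg'.
have hcv t : (fun n => h n t) @ \oo --> g t.
  have := @cvg_nnsfun_approx _ TR R setT measurableT _ mg' (fun x _ => _) t I.
  move=> /(_ (fun x => ltac:(by rewrite lee_fin)))/fine_cvgP[]; exact.
have hle n t : h n t <= g t.
  rewrite -(cvg_lim _ (hcv t))//; apply: nondecreasing_cvgn_le; last first.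
    by apply/cvg_ex; exists (g t); exact: hcv.
  by move=> m k mk; have /lefP := nd_nnsfun_approx (@measurableT _ TR) mg' mk; exact.
have h0 n t : 0 <= h n t by [].
apply: (approximable_closed (@L2_trig R) (L2_circle_mul gL)) => eps eps0.
pose G n t : R[i] := (\1_circle t)%:C * (h n t)%:C.
have GE n t : nsq ((\1_circle t)%:C * (g t)%:C - G n t) = \1_circle t * (g t - h n t) ^+ 2.
  by rewrite -mulrBr nsq_indicM -rmorphB nsq_real.
have mG n : cmeas (G n).
  by apply: cmeasM; [exact: cmeas_indic|apply: cmeas_real; exact: measurable_funP].
have LG n : L2 (G n).
  apply: (@L2_le _ _ (fun t => nsq (g t)%:C)) => //; last exact: L2_rint.
  move=> t; rewrite nsq_indicM !nsq_real; have /andP[? ?] := indic_itv01 circle t.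
  by rewrite -[leRHS]mul1r ler_pM ?sqr_ge0// lerXn2r ?nnegrE.
have [||n Hn] := @nrm2_dominated _ G _ _ mG (L2_cmeas (L2_circle_mul gL)) (L2_rint gL) _ _ _ eps0.
- move=> n t; rewrite GE nsq_real; have /andP[? ?] := indic_itv01 circle t.
  rewrite -[leRHS]mul1r ler_pM ?sqr_ge0// lerXn2r ?nnegrE ?subr_ge0//.
  by rewrite gerBl.
- apply: aeW => t; under eq_fun do rewrite GE.
  have c0 : (fun n => g t - h n t) @ \oo --> (0 : R).
    by have := cvgB (cvg_cst (g t)) (hcv t); rewrite subrr; exact.
  under eq_fun do rewrite expr2.
  by have := cvgM (cvg_cst (\1_circle t : R)) (cvgM c0 c0); rewrite !mulr0; exact.
exists (G n); split => //.
rewrite (_ : G n = fun t => \sum_(y <- finmap.enum_fset (fset_set (range (h n))))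
   y%:C * ((\1_circle t)%:C * (\1_(h n @^-1` [set y]) t)%:C)).
  have mp y : measurable (h n @^-1` [set y] : set TR).
    by rewrite -[X in measurable X]setTI; exact: measurable_funP.
  apply: approximable_sum => y.
  - by apply: L2_trig.
  - by apply: L2Z; exact: L2_indic_circle.
  - apply: approximableZ; [exact: L2_trig|exact: L2_indic_circle|exact: approximable_measurable].
apply/funext => t; rewrite /G (fimfunE (h n)) fsbig_finite//= rmorph_sum big_distrr/=.
by apply: eq_bigr => y _; rewrite rmorphM; ring.
Qed.

Lemma approximable_real (g : R -> R) :
  L2 (fun t => (g t)%:C) -> approximable trig (fun t => (\1_circle t)%:C * (g t)%:C).
Proof.
move=> gL; have mg : measurable_fun [set: TR] g by case: (L2_cmeas gL).
have L2max (k : R -> R) : measurable_fun [set: TR] k -> (forall t, k t ^+ 2 = g t ^+ 2) ->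
    L2 (fun t => (Num.max (k t) 0)%:C).
  move=> mk kg; apply: (@L2_le _ _ (fun t => nsq (g t)%:C)); last exact: L2_rint.
  - by apply: cmeas_real; apply: measurable_maxr.
  - move=> t; rewrite !nsq_real -kg; case: (leP (k t) 0) => _; last exact: lexx.
    by rewrite expr2 mul0r sqr_ge0.
have L1 := L2max g mg (fun=> erefl).
have L2 := L2max (fun t => - g t) (measurable_funN mg) (fun t => sqrrN (g t)).
rewrite (_ : (fun t => _) = fun t => (\1_circle t)%:C * (Num.max (g t) 0)%:C +
   -1 * ((\1_circle t)%:C * (Num.max (- g t) 0)%:C)); last first.
  apply/funext => t; rewrite mulN1r -mulrBr -rmorphB; congr (_ * _%:C).
  by case: (leP (g t) 0) => gt; case: (leP (- g t) 0) => gt'; lra.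
apply: approximableD.
- exact: L2_trig.
- exact: L2_circle_mul.
- by apply: L2Z; exact: L2_circle_mul.
- by apply: approximable_nonneg => // t; rewrite le_max lexx orbT.
- apply: approximableZ; [exact: L2_trig|exact: L2_circle_mul|].
  by apply: approximable_nonneg => // t; rewrite le_max lexx orbT.
Qed.

Lemma approximable_trig (f : R -> R[i]) : L2 f ->
  approximable trig (fun t => (\1_circle t)%:C * f t).
Proof.
move=> fL; have [mf1 mf2] := L2_cmeas fL.
have LR : L2 (fun t => (cRe (f t))%:C).
  apply: (@L2_le _ _ (fun t => nsq (f t))); last exact: L2_rint.
  - exact: cmeas_real.
  - by move=> t; rewrite nsq_real /nsq lerDl sqr_ge0.
have LI : L2 (fun t => (cIm (f t))%:C).
  apply: (@L2_le _ _ (fun t => nsq (f t))); last exact: L2_rint.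
  - exact: cmeas_real.
  - by move=> t; rewrite nsq_real /nsq lerDr sqr_ge0.
rewrite (_ : (fun t => _) = fun t => (\1_circle t)%:C * (cRe (f t))%:C +
   'i%C * ((\1_circle t)%:C * (cIm (f t))%:C)); last first.
  by apply/funext => t; apply: complex_ext; rewrite !ReImE/=; ring.
apply: approximableD.
- exact: L2_trig.
- exact: L2_circle_mul.
- by apply: L2Z; exact: L2_circle_mul.
- exact: approximable_real.
- by apply: approximableZ; [exact: L2_trig|exact: L2_circle_mul|exact: approximable_real].
Qed.

(** The exponentials here are not normalized: Parseval's identity is applied to sqrt(2 pi) f, which
    clears the normalization from the coefficients and leaves 2 pi on the right. *)
Lemma circle_parseval (f : R -> R[i]) : L2 f -> (forall t, ~ circle t -> f t = 0) ->
  (\esum_(k in [set: int]) (nsq (cintegral (fun t => f t * cexpi (- (k%:~R * t)))))%:E =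
   (2 * pi * nrm2 f)%:E)%E.
Proof.
move=> fL f0.
have s0 : 0 < Num.sqrt (2 * pi) :> R by rewrite sqrtr_gt0 two_pi_gt0.
pose c : R[i] := (Num.sqrt (2 * pi))%:C.
have gE : (fun t => (\1_circle t)%:C * (c * f t)) = fun t => c * f t.
  apply/funext => t; rewrite indicE; case: (boolP (t \in circle)) => tc; first by rewrite mul1r.
  by rewrite mul0r f0 ?mulr0//; move/negP: tc; rewrite inE.
have gL : L2 (fun t => c * f t) by exact: L2Z.
have := approximable_parseval (@L2_trig R) (@trig_orthonormal R) gL.
rewrite -{1}gE => /(_ (approximable_trig gL)).
rewrite nrm2Z// /c nsq_real sqr_sqrtr ?ltW ?two_pi_gt0// => <-.
apply: eq_esum => k _; congr (nsq _)%:E; apply: eq_cintegral => t.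
rewrite -cexpi_conj; have [tc|tc] := pselect (circle t); last first.
  by rewrite f0// mulr0 !mul0r.
have -> : trig k t = ((Num.sqrt (2 * pi))^-1)%:C * cexpi (k%:~R * t).
  by rewrite /trig indicE mem_set// mul1r.
rewrite conjc_realM; have : c * ((Num.sqrt (2 * pi))^-1)%:C = 1.
  by rewrite -rmorphM mulfV// gt_eqF.
move: (_^-1)%:C (cexpi _)^*%C; rewrite -/c; move: (c) => x y z xy.
by rewrite -[LHS]mul1r -xy; ring.
Qed.

End TrigComplete.

(** * Changes of variable and unfolding *)

Section Affine.
Context {R : realType}.
Local Notation mu := (@lebesgue_measure R).
Local Notation TR := (measurableTypeR R).

Definition affine (a b x : R) : R := a * x + b.

Lemma measurable_affine a b : measurable_fun [set: TR] (affine a b : TR -> TR).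
Proof. by apply: measurable_funD => //; exact: mulrl_measurable. Qed.

(** By uniqueness of Lebesgue measure it suffices to compare both sides on intervals ]x, y]; for
    negative a the preimage is closed on the left and open on the right instead. *)
Lemma lebesgue_measure_affine (a b : R) (A : set R) : a != 0 -> measurable (A : set TR) ->
  mu A = (`|a|%:E * mu (affine a b @^-1` A))%E.
Proof.
move=> a0 mA.
have a_ge0 : 0 <= `|a| by [].
pose P := measure_function_pushforward__canonical__measure_function_Measure mu
  (measurable_affine a b).
pose nu : {measure set TR -> \bar R} := mscale (NngNum a_ge0) P.
rewrite (@lebesgue_measure_unique R nu)// => _ [[x y]/= _ <-].
have ay c : a^-1 * c - a^-1 * b = (c - b) / a by rewrite -mulrBr mulrC.
rewrite /nu/= /mscale/= /pushforward.
have [a1|a1] := ltP 0 a.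
  rewrite (_ : _ @^-1` _ = `](x - b) / a, (y - b) / a]%classic); last first.
    apply/seteqP; split => t /=; rewrite !in_itv/= /affine ltr_pdivrMr// ler_pdivlMr//
      ltrBlDr lerBrDr mulrC; exact.
  rewrite !lebesgue_measure_itv/= !lte_fin ltr_pM2r ?invr_gt0// ltrD2r.
  case: ifPn => _; last by rewrite mule0.
  by rewrite gtr0_norm// -!EFinD -EFinM; congr EFin; field; rewrite gt_eqF.
have {}a1 : a < 0 by rewrite lt_neqAle a0.
rewrite (_ : _ @^-1` _ = `[(y - b) / a, (x - b) / a[%classic); last first.
  apply/seteqP; split => t /=; rewrite !in_itv/= /affine ltr_ndivlMr// ler_ndivrMr//
    ltrBlDr lerBrDr mulrC => /andP[? ?]; exact/andP.
rewrite !lebesgue_measure_itv/= !lte_fin ltr_nM2r ?invr_lt0// ltrD2r.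
case: ifPn => _; last by rewrite mule0.
by rewrite ltr0_norm// -!EFinD -EFinM; congr EFin; field; rewrite lt_eqF.
Qed.

Lemma ge0_integral_affine (a b : R) (f : R -> \bar R) : a != 0 ->
  measurable_fun [set: TR] f -> (forall x, 0 <= f x)%E ->
  (\int[mu]_x f x = `|a|%:E * \int[mu]_x f (affine a b x))%E.
Proof.
move=> a0 mf f0; have a_ge0 : 0 <= `|a| by [].
pose P := measure_function_pushforward__canonical__measure_function_Measure mu
  (measurable_affine a b).
pose nu : {measure set TR -> \bar R} := mscale (NngNum a_ge0) P.
rewrite (@eq_measure_integral _ TR R setT nu mu f); last first.
  by move=> A mA _; exact: lebesgue_measure_affine.
rewrite ge0_integral_mscale//; congr (_ * _)%E.
by rewrite (ge0_integral_pushforward (measurable_affine a b)) ?preimage_setT.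
Qed.

Lemma rint_affine (a b : R) (f : R -> R) : a != 0 -> rint f -> rint (f \o affine a b).
Proof.
move=> a0 fi; have mf := rint_cmeas fi.
apply/integrableP; split.
  by apply/measurable_EFinP; apply: (measurableT_comp mf); exact: measurable_affine.
move/integrableP : fi => [_]; rewrite (ge0_integral_affine b a0)//; last first.
  by apply: measurableT_comp => //; exact/measurable_EFinP.
apply: contraTT; rewrite -!leNgt !leye_eq => /eqP.
by rewrite /= => ->; rewrite gt0_muley// lte_fin normr_gt0.
Qed.

Lemma Rint_affine (a b : R) (f : R -> R) : a != 0 -> rint f ->
  \int[mu]_x f x = `|a| * \int[mu]_x f (affine a b x).
Proof.
move=> a0 fi; have fai := rint_affine b a0 fi.
have mf : measurable_fun [set: TR] (EFin \o f) by apply/measurable_EFinP; exact: rint_cmeas.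
apply: EFin_inj; rewrite EFinM !Rint_EFin//.
rewrite integralE [in RHS]integralE.
rewrite (ge0_integral_affine b a0 (measurable_funepos mf))//.
rewrite (ge0_integral_affine b a0 (measurable_funeneg mf))//.
rewrite -muleBr//; last first.
  apply: fin_num_adde_defl; rewrite fin_numN.
  have := @integrable_neg_fin_num _ TR R mu setT measurableT (EFin \o (f \o affine a b)) fai.
  by rewrite compA funeneg_comp.
have E : (fun x => (f (affine a b x))%:E) = (EFin \o f) \o affine a b by [].
by rewrite [in RHS]E [in RHS](funepos_comp (EFin \o f)) [in RHS](funeneg_comp (EFin \o f)).
Qed.

Lemma cint_affine (a b : R) (f : R -> R[i]) : a != 0 -> cint f -> cint (f \o affine a b).
Proof.
by move=> a0 [f1 f2]; split; [exact: (rint_affine b a0 f1)|exact: (rint_affine b a0 f2)].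
Qed.

Lemma cintegral_affine (a b : R) (f : R -> R[i]) : a != 0 -> cint f ->
  cintegral f = `|a|%:C * cintegral (f \o affine a b).
Proof.
move=> a0 [f1 f2]; rewrite /cintegral; apply: complex_ext; rewrite ?cReM ?cImM /= mul0r.
- by rewrite subr0; exact: Rint_affine.
- by rewrite addr0; exact: Rint_affine.
Qed.

Lemma L2_affine (a b : R) (f : R -> R[i]) : a != 0 -> L2 f -> L2 (f \o affine a b).
Proof.
move=> a0 /L2P[mf fi]; apply/L2P; split.
  by apply: cmeas_comp => //; exact: measurable_affine.
exact: (rint_affine b a0 fi).
Qed.

Lemma nrm2_affine (a b : R) (f : R -> R[i]) : a != 0 -> L2 f ->
  nrm2 f = `|a| * nrm2 (f \o affine a b).
Proof. by move=> a0 /L2_rint; exact: Rint_affine. Qed.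

End Affine.

(** * Sums over the integers *)

Section EsumInt.
Context {R : realType}.

(** Enumerates the integers as 0, -1, 1, -2, 2, ..., turning sums over them into series that can be
    exchanged with the integral. *)
Definition int_of_nat (n : nat) : int := if odd n then Negz n./2 else Posz n./2.

Lemma int_of_nat_bij : set_bij [set: nat] [set: int] int_of_nat.
Proof.
split => //.
- move=> m n _ _; rewrite /int_of_nat; case: ifP => om; case: ifP => on // [mn];
    by rewrite -(odd_double_half m) -(odd_double_half n) om on mn.
- move=> k _; case: k => n.
  + by exists n.*2 => //; rewrite /int_of_nat odd_double doubleK.
  + by exists n.*2.+1 => //; rewrite /int_of_nat/= odd_double/= uphalf_double.
Qed.

Lemma esum_int (a : int -> \bar R) : (forall k, 0 <= a k)%E ->
  (\esum_(k in [set: int]) a k = \sum_(n <oo) a (int_of_nat n))%E.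
Proof.
by move=> a0; rewrite (@reindex_esum _ _ _ _ _ _ a int_of_nat_bij) nneseries_esumT.
Qed.

Lemma integral_esum_int d (T : measurableType d) (m : {measure set T -> \bar R})
    (D : set T) (f : int -> T -> \bar R) : measurable D ->
  (forall k, measurable_fun D (f k)) -> (forall k x, 0 <= f k x)%E ->
  (\int[m]_(x in D) (\esum_(k in [set: int]) f k x) =
   \esum_(k in [set: int]) (\int[m]_(x in D) f k x))%E.
Proof.
move=> mD mf f0; rewrite esum_int; last by move=> k; exact: integral_ge0.
under eq_integral do rewrite esum_int//.
by rewrite integral_nneseries.
Qed.

Lemma esum_int1 (a : int -> \bar R) (k : int) : (forall j, 0 <= a j)%E ->
  (forall j, j != k -> a j = 0%E) -> (\esum_(j in [set: int]) a j = a k)%E.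
Proof.
move=> a_ge0 a0; rewrite (esumID [set k])// setTI esum_set1//.
by rewrite esum1 ?adde0// => j [_ /eqP]; exact: a0.
Qed.

End EsumInt.

(** * Folding the line onto a fundamental domain *)

Section Tiling.
Context {R : realType}.
Local Notation mu := (@lebesgue_measure R).
Local Notation TR := (measurableTypeR R).

(** The indicators of the translates of D sum to 1 at every point. Inserting that sum, exchanging it
    with the integral and shifting each term moves all the mass into D. *)
Lemma ge0_integral_translates (D : set R) (c : R) (h : R -> \bar R) :
  measurable (D : set TR) -> (forall x, exists k : int, D (x + k%:~R * c)) ->
  (forall x (j k : int), D (x + j%:~R * c) -> D (x + k%:~R * c) -> j = k) ->
  measurable_fun [set: TR] h -> (forall x, 0 <= h x)%E ->
  (\int[mu]_x h x = \int[mu]_(x in D) (\esum_(k in [set: int]) h (x - k%:~R * c)%R))%E.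
Proof.
move=> mD Dex Duniq mh h0.
have mt (b : R) : measurable_fun [set: TR] (fun x : R => x + b).
  by apply: measurable_funD => //; exact: measurable_cst.
have mhk b : measurable_fun [set: TR] (fun x => h (x + b)%R).
  exact: (measurableT_comp mh (mt b)).
have m1 b : measurable_fun [set: TR] (fun x => (\1_D (x + b)%R : R)%:E).
  by apply/measurable_EFinP; apply: (measurableT_comp _ (mt b)); exact: measurable_indic.
rewrite integral_esum_int//; last by move=> k; exact: measurable_funTS.
transitivity (\int[mu]_x (\esum_(k in [set: int]) ((\1_D (x + k%:~R * c)%R : R)%:E * h x)))%E.
  apply: eq_integral => x _; have [k Dk] := Dex x.
  rewrite (@esum_int1 _ _ k).
  - by rewrite indicE mem_set// mul1e.
  - by move=> j; rewrite mule_ge0// lee_fin indicE.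
  - move=> j /eqP jk; rewrite indicE memNset ?mul0e// => Dj.
    by apply: jk; exact: Duniq Dj Dk.
rewrite integral_esum_int//.
- apply: eq_esum => k _.
  rewrite (@ge0_integral_affine _ 1 (- (k%:~R * c)))//.
  + rewrite normr1 mul1e [RHS]integral_mkcond; apply: eq_integral => x _.
    rewrite /affine mul1r subrK patchE indicE; case: (x \in D); rewrite ?mul1e ?mul0e//.
  + by apply: emeasurable_funM.
  + by move=> x; rewrite mule_ge0// lee_fin indicE.
- by move=> k; apply: emeasurable_funM.
- by move=> k x; rewrite mule_ge0// lee_fin indicE.
Qed.

End Tiling.

(** * The Fourier integral of bounded compactly supported functions *)

Section Tame.
Context {R : realType}.
Local Notation mu := (@lebesgue_measure R).
Local Notation TR := (measurableTypeR R).
Local Notation cRe := (@complex.Re R).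
Local Notation cIm := (@complex.Im R).
Implicit Types f g : R -> R[i].

(** A class contained in L1 and in L2, so that [inverse_fourier] is a convergent integral on it; it
    is stable under modulation and dilation, and dense in L2. *)
Definition tame g : Prop :=
  [/\ cmeas g, exists B : R, forall t, nsq (g t) <= B
    & exists T : R, forall t, T < `|t| -> g t = 0].

Lemma eq_tame f g : f =1 g -> tame f -> tame g. Proof. by move/funext => ->. Qed.

Lemma tame_bounded_mul f g (B : R) : cmeas f -> (forall t, nsq (f t) <= B) -> tame g ->
  tame (fun t => f t * g t).
Proof.
move=> mf fB [mg [C gC] [T gT]]; split; first exact: cmeasM.
- exists (B * C) => t; rewrite nsqM ler_pM// nsq_ge0//.
- by exists T => t /gT ->; rewrite mulr0.
Qed.

Lemma tameZ c g : tame g -> tame (fun t => c * g t).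
Proof. by apply: (@tame_bounded_mul _ _ (nsq c)) => //; exact: cmeas_cst. Qed.

Lemma tame_cexpi (h : R -> R) g : measurable_fun [set: TR] h -> tame g ->
  tame (fun t => cexpi (h t) * g t).
Proof.
move=> mh; apply: (@tame_bounded_mul _ _ 1); first exact: cmeas_cexpi.
by move=> t; rewrite nsq_cexpi.
Qed.

Lemma tameD f g : tame f -> tame g -> tame (fun t => f t + g t).
Proof.
move=> [mf [B fB] [S fS]] [mg [C gC] [T gT]]; split; first exact: cmeasD.
- exists (2 * B + 2 * C) => t; apply: le_trans (nsqD_le _ _) _.
  by rewrite lerD// ler_pM2l.
- exists (Num.max S T) => t; rewrite gt_max => /andP[St Tt].
  by rewrite fS// gT// addr0.
Qed.

Lemma tame_affine (a : R) g : a != 0 -> tame g -> tame (g \o affine a 0).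
Proof.
move=> a0 [mg [C gC] [T gT]]; split.
- by apply: cmeas_comp => //; exact: measurable_affine.
- by exists C => t; exact: gC.
- exists (T / `|a|) => t; rewrite ltr_pdivrMr ?normr_gt0// => Tt.
  by rewrite /= gT// /affine addr0 normrM mulrC.
Qed.

Lemma tame_majorant g : tame g ->
  exists2 h : R -> R, rint h & forall t, `|cRe (g t)| + `|cIm (g t)| <= h t /\ nsq (g t) <= h t.
Proof.
move=> [mg [C gC] [T gT]].
have mI : measurable (`[- T, T]%classic : set TR) by exact: measurable_itv.
(* Since 2 x <= x^2 + 1, the constant 2 + 2 C dominates the sum of the components as well as the
   squared modulus. *)
exists (fun t => (2 + 2 * C) * \1_`[- T, T]%classic t).
  apply: rintZ; apply: rint_indic => //; rewrite lebesgue_measure_itv/=.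
  case: ifPn => _; [by rewrite -EFinB ltry|exact: ltry].
move=> t; rewrite indicE; have [tT|tT] := leP `|t| T.
  rewrite mem_set; last by rewrite /= in_itv/= -ler_norml.
  rewrite mulr1; have := gC t; rewrite /nsq.
  have := sqr_ge0 (`|cRe (g t)| - 1); have := sqr_ge0 (`|cIm (g t)| - 1).
  rewrite -[cRe (g t) ^+ 2]real_normK ?num_real// -[cIm (g t) ^+ 2]real_normK ?num_real//.
  have := sqr_ge0 `|cRe (g t)|; have := sqr_ge0 `|cIm (g t)|.
  by move=> *; split; nra.
rewrite gT// memNset ?mulr0 ?nsq0//= ?normr0 ?addr0//.
by rewrite in_itv/= -ler_norml => /(lt_le_trans tT); rewrite ltxx.
Qed.

Lemma L2_tame g : tame g -> L2 g.
Proof.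
move=> tg; have [h ih gh] := tame_majorant tg; case: tg => mg _ _.
by apply: (L2_le mg _ ih) => t; case: (gh t).
Qed.

Lemma cint_tame g : tame g -> cint g.
Proof.
move=> tg; have [h ih gh] := tame_majorant tg; case: tg => mg _ _.
apply: (le_cint mg _ _ ih) => t; have [] := gh t => + _; apply: le_trans.
  by rewrite lerDl.
by rewrite lerDr.
Qed.

Lemma tame_inverse_fourier_cint g t : tame g -> cint (fun s => cexpi (s * t) * g s).
Proof. by move=> tg; apply: cint_tame; apply: tame_cexpi => //; exact: mulrr_measurable. Qed.

Lemma inverse_fourierD f g t : tame f -> tame g ->
  inverse_fourier (fun s => f s + g s) t = inverse_fourier f t + inverse_fourier g t.
Proof.
move=> tf tg; rewrite /inverse_fourier -mulrDr -cintegralD; [|exact: tame_inverse_fourier_cint..].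
by congr (_ * _); apply: eq_cintegral => s; rewrite mulrDr.
Qed.

Lemma inverse_fourierZ c g t : tame g ->
  inverse_fourier (fun s => c * g s) t = c * inverse_fourier g t.
Proof.
move=> tg; rewrite /inverse_fourier [RHS]mulrCA; congr (_ * _).
rewrite -cintegralZ; last exact: tame_inverse_fourier_cint.
by apply: eq_cintegral => s; rewrite mulrCA.
Qed.

(** Domination makes the integral continuous in the parameter, and continuity gives
    measurability. *)
Lemma continuous_measurable_param (F : R -> R -> R) (h : R -> R) :
  (forall t, measurable_fun [set: TR] (F t)) -> (forall s, continuous (fun t => F t s)) ->
  rint h -> (forall t s, `|F t s| <= h s) ->
  measurable_fun [set: TR] (fun t => \int[mu]_s F t s).
Proof.
move=> mF cF ih Fh; apply: continuous_measurable_fun => x.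
have := @continuity_under_integral R _ TR mu F setT measurableT (x - 1) (x + 1) _ _ h ih _ x.
apply.
- by move=> t _; exact: (le_rint (mF t) (Fh t) ih).
- by apply: aeW => s _ t _; exact: cF.
- by move=> t _; apply: aeW => s _; exact: Fh.
- by rewrite inE/= in_itv/=; apply/andP; split; lra.
Qed.

Lemma cmeas_inverse_fourier g : tame g -> cmeas (inverse_fourier g).
Proof.
move=> tg; have [h ih gh] := tame_majorant tg; have [[mg1 mg2] _ _] := tg.
apply: cmeasZ.
have mcos (t : R) : measurable_fun [set: TR] (fun s => cos (s * t)).
  by apply: measurable_cos_comp; exact: mulrr_measurable.
have msin (t : R) : measurable_fun [set: TR] (fun s => sin (s * t)).
  by apply: measurable_sin_comp; exact: mulrr_measurable.
have cc (s : R) : continuous (fun t => cos (s * t)).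
  by apply: continuous_mul_comp; exact: continuous_cos.
have cs (s : R) : continuous (fun t => sin (s * t)).
  by apply: continuous_mul_comp; exact: continuous_sin.
have bnd (x y a b : R) : `|x| <= 1 -> `|y| <= 1 -> `|x * a| + `|y * b| <= `|a| + `|b|.
  by move=> x1 y1; rewrite !normrM lerD// ler_piMl.
split => /=.
- apply: (@continuous_measurable_param (fun t s => cRe (cexpi (s * t) * g s)) h) => //.
  + move=> t; under eq_fun do rewrite cReM/=.
    by apply: measurable_funB; apply: measurable_funM.
  + move=> s; under eq_fun do rewrite cReM/=.
    move=> t; apply: cvgB; apply: cvgM; [exact: cc|exact: cvg_cst|exact: cs|exact: cvg_cst].
  + move=> t s; rewrite cReM/=; have [] := gh s => + _; apply: le_trans.
    by apply: le_trans (ler_normB _ _) _; apply: bnd; [exact: cos_max|exact: sin_max].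
- apply: (@continuous_measurable_param (fun t s => cIm (cexpi (s * t) * g s)) h) => //.
  + move=> t; under eq_fun do rewrite cImM/=.
    by apply: measurable_funD; apply: measurable_funM.
  + move=> s; under eq_fun do rewrite cImM/=.
    move=> t; apply: cvgD; apply: cvgM; [exact: cc|exact: cvg_cst|exact: cs|exact: cvg_cst].
  + move=> t s; rewrite cImM/=; have [] := gh s => + _; apply: le_trans.
    apply: le_trans (ler_normD _ _) _; rewrite addrC [leRHS]addrC.
    by rewrite addrC [leRHS]addrC addrC; apply: bnd; [exact: sin_max|exact: cos_max].
Qed.

End Tame.

(** * The Plancherel theorem *)

Section Plancherel.
Context {R : realType}.
Local Notation mu := (@lebesgue_measure R).
Local Notation TR := (measurableTypeR R).
Local Notation cRe := (@complex.Re R).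
Local Notation cIm := (@complex.Im R).
Implicit Types f g : R -> R[i].

Let c0 : R[i] := ((Num.sqrt (2 * pi))^-1)%:C.

(** The values at the points x - k are, up to normalization, the Fourier coefficients of exp(i x s)
    g(s), whose modulus is that of g. *)
Lemma inverse_fourier_parseval g (x : R) : tame g -> (forall t, ~ circle t -> g t = 0) ->
  (\esum_(k in [set: int]) (nsq (inverse_fourier g (x - k%:~R)))%:E = (nrm2 g)%:E)%E.
Proof.
move=> tg g0; have tf : tame (fun s => c0 * (cexpi (x * s) * g s)).
  by apply: tameZ; apply: tame_cexpi => //; exact: measurable_mull.
have := circle_parseval (L2_tame tf).
have -> : 2 * pi * nrm2 (fun s => c0 * (cexpi (x * s) * g s)) = nrm2 g.
  rewrite nrm2Z; last by apply: L2_tame; apply: tame_cexpi => //; exact: measurable_mull.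
  rewrite nsq_sqrt_two_pi mulrA mulfV ?gt_eqF ?two_pi_gt0// mul1r.
  by apply: eq_Rintegral => s _; rewrite nsqM nsq_cexpi mul1r.
move=> <-; last by move=> t /g0 ->; rewrite !mulr0.
apply: eq_esum => k _; congr (nsq _)%:E; rewrite /inverse_fourier -/c0 -cintegralZ; last first.
  exact: tame_inverse_fourier_cint.
apply: eq_cintegral => s.
by rewrite mulrBr cexpiD (mulrC s x) (mulrC s k%:~R); ring.
Qed.

Lemma measurable_nsq_inverse_fourier g : tame g ->
  measurable_fun [set: TR] (fun t => (nsq (inverse_fourier g t))%:E).
Proof. by move=> tg; apply/measurable_EFinP; exact: measurable_nsq (cmeas_inverse_fourier tg). Qed.

(** Folding the line onto [0, 1) by integer translations turns the integrand into the sum of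
    [inverse_fourier_parseval], which does not depend on x. *)
Lemma plancherel_circle g : tame g -> (forall t, ~ circle t -> g t = 0) ->
  (\int[mu]_t (nsq (inverse_fourier g t))%:E = (nrm2 g)%:E)%E.
Proof.
move=> tg g0.
have mI : measurable (`[0, 1[%classic : set TR) by exact: measurable_itv.
rewrite (@ge0_integral_translates _ `[0, 1[%classic 1)//.
- under eq_integral do under eq_esum do rewrite mulr1.
  under eq_integral do rewrite inverse_fourier_parseval//.
  transitivity ((nrm2 g)%:E * mu (`[0%R, 1%R[%classic : set R))%E; first exact: integral_cst.
  by rewrite lebesgue_measure_itv/= lte01 -EFinB subr0 mule1.
- move=> x; exists (- Num.floor x); rewrite /= in_itv/= mulr1 intrN.
  have := floor_itv x; rewrite intrD; lra.
- move=> x j k /=; rewrite !in_itv/= !mulr1 => h1 h2; apply/eqP.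
  rewrite eq_le -!ltzD1 -!(ltr_int R) !intrD; lra.
- exact: measurable_nsq_inverse_fourier.
- by move=> t; rewrite lee_fin nsq_ge0.
Qed.

(** Dilation by a large a shrinks the support, which reduces Plancherel to functions supported in
    [circle]. *)
Lemma inverse_fourier_affine (a : R) g t : 0 < a -> tame g ->
  inverse_fourier g t = a%:C * inverse_fourier (g \o affine a 0) (a * t).
Proof.
move=> a0 tg; rewrite /inverse_fourier mulrCA; congr (_ * _).
rewrite (@cintegral_affine _ a 0) ?gt_eqF//; last exact: tame_inverse_fourier_cint.
rewrite gtr0_norm//; congr (_ * _); apply: eq_cintegral => s /=.
by rewrite /affine addr0; congr (cexpi _ * _); ring.
Qed.

Lemma L2_nrm2_inverse_fourier g : tame g ->
  L2 (inverse_fourier g) /\ nrm2 (inverse_fourier g) = nrm2 g.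
Proof.
move=> tg; have [mg _ [T gT]] := tg.
(* Outside [circle] one has |t| >= pi >= 1, hence |a t| >= a > T, where g vanishes. *)
pose a : R := `|T| + 1.
have a0 : 0 < a by rewrite ltr_wpDl.
have a0' : a != 0 by rewrite gt_eqF.
have tga : tame (g \o affine a 0) by apply: tame_affine.
have gaD t : ~ circle t -> (g \o affine a 0) t = 0.
  move=> tD; apply: gT; rewrite /affine addr0 normrM gtr0_norm//.
  have pi1 : 1 <= pi :> R by have := @pi_ge2 R; lra.
  have tpi : pi <= `|t|.
    rewrite leNgt; apply/negP; rewrite ltr_norml => /andP[t1 t2].
    by apply: tD; rewrite /circle/= in_itv/= (ltW t1) t2.
  apply: (@lt_le_trans _ _ a); first by rewrite (le_lt_trans (ler_norm _))// ltrDl.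
  by rewrite ler_peMr ?(ltW a0)// (le_trans pi1).
have P := plancherel_circle tga gaD.
have LUa : L2 (inverse_fourier (g \o affine a 0)).
  apply/L2P; split; first exact: cmeas_inverse_fourier.
  apply: rint_lty; [exact: measurable_nsq (cmeas_inverse_fourier tga)|by move=> t; exact: nsq_ge0|].
  by rewrite P ltry.
have E : inverse_fourier g = fun t => a%:C * (inverse_fourier (g \o affine a 0) \o affine a 0) t.
  by apply/funext => t; rewrite (inverse_fourier_affine _ a0)//= /affine addr0.
have NUa : nrm2 (inverse_fourier (g \o affine a 0)) = nrm2 (g \o affine a 0).
  by apply: EFin_inj; rewrite nrm2E.
split; first by rewrite E; apply: L2Z; exact: L2_affine.
rewrite E nrm2Z; last exact: L2_affine.
rewrite (nrm2_affine 0 a0' (L2_tame tg)) -NUa (nrm2_affine 0 a0' LUa) nsq_real gtr0_norm//.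
by rewrite expr2 mulrA.
Qed.

Lemma L2_inverse_fourier g : tame g -> L2 (inverse_fourier g).
Proof. by case/L2_nrm2_inverse_fourier. Qed.

Lemma plancherel g : tame g -> nrm2 (inverse_fourier g) = nrm2 g.
Proof. by case/L2_nrm2_inverse_fourier. Qed.

(** Polarization: the norm of a sum yields the real part of the inner product, and replacing g by i
    g yields the imaginary part. *)
Lemma plancherel_dot f g : tame f -> tame g ->
  L2dot (inverse_fourier f) (inverse_fourier g) = L2dot f g.
Proof.
suff key f' g' : tame f' -> tame g' ->
    cRe (L2dot (inverse_fourier f') (inverse_fourier g')) = cRe (L2dot f' g').
  move=> tf tg; apply: complex_ext; first exact: key.
  have := key _ _ tf (tameZ 'i%C tg).
  have -> : inverse_fourier (fun t => 'i%C * g t) = fun t => 'i%C * inverse_fourier g t.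
    by apply/funext => t; rewrite inverse_fourierZ.
  rewrite (L2dotZr _ (L2_inverse_fourier tg) (L2_inverse_fourier tf)).
  rewrite (L2dotZr _ (L2_tame tg) (L2_tame tf)).
  by rewrite !cReM !cRe_conj !cIm_conj/= !mul0r !sub0r !mulN1r !opprK.
move=> tf tg; have := plancherel (tameD tf tg).
have -> : inverse_fourier (fun t => f' t + g' t) =
    fun t => inverse_fourier f' t + inverse_fourier g' t.
  by apply/funext => t; rewrite inverse_fourierD.
rewrite nrm2D; [|exact: L2_inverse_fourier..].
rewrite nrm2D; [|exact: L2_tame..].
by rewrite !plancherel// => H; lra.
Qed.

(** Fubini's theorem; the product majorant makes the kernel integrable on the plane and every
    section integrable on the line. *)
Lemma Rint_swap (K : R -> R -> R) (h1 h2 : R -> R) :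
  measurable_fun [set: TR * TR] (fun z => K z.1 z.2) -> rint h1 -> rint h2 ->
  (forall t s, `|K t s| <= h1 t * h2 s) ->
  \int[mu]_t \int[mu]_s K t s = \int[mu]_s \int[mu]_t K t s.
Proof.
move=> mK i1 i2 Kh.
have mK1 t : measurable_fun [set: TR] (fun s => K t s).
  exact: (measurableT_comp mK (pair1_measurable t)).
have mK2 s : measurable_fun [set: TR] (fun t => K t s).
  exact: (measurableT_comp mK (pair2_measurable s)).
have iK1 t : rint (fun s => K t s).
  by apply: (le_rint (mK1 t) (Kh t)); exact: rintZ.
have iK2 s : rint (fun t => K t s).
  apply: (le_rint (mK2 s) (fun t => Kh t s)).
  by apply: eq_rint (rintZ (h2 s) i1) => t; rewrite mulrC.
have iK : (mu \x mu)%E.-integrable [set: TR * TR] (EFin \o (fun z => K z.1 z.2)).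
  apply/integrable12ltyP; first exact/measurable_EFinP.
  apply: (@le_lt_trans _ _ (\int[mu]_t ((\int[mu]_s h2 s) * h1 t)%:E)%E); last first.
    by apply: integrable_lty => //; exact: rintZ.
  apply: ge0_le_integral => //.
  - by move=> t _; exact: integral_ge0.
  - apply: (@measurable_fun_fubini_tonelli_F _ _ TR TR R mu (fun z => `|(K z.1 z.2)%:E|%E)) => //.
    by apply: measurableT_comp => //; exact/measurable_EFinP.
  - apply/measurable_EFinP; apply: measurable_funM => //; exact: rint_cmeas.
  - move=> t _; rewrite mulrC -RintZ// Rint_EFin; last exact: rintZ.
    apply: ge0_le_integral => //.
    + change (measurable_fun [set: TR] (EFin \o (Num.Def.normr \o K t))).
      by apply/measurable_EFinP; apply: measurableT_comp (mK1 t).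
    + by apply/measurable_EFinP; apply: measurable_funM => //; exact: rint_cmeas.
    + by move=> s _; rewrite lee_fin; exact: Kh.
have := @Fubini _ _ TR TR R mu mu _ iK; rewrite /Rintegral => E.
congr fine; under eq_integral do rewrite -/(Rintegral _ _ _) Rint_EFin//.
rewrite E; apply: eq_integral => s _.
by rewrite -/(Rintegral _ _ _) Rint_EFin.
Qed.

Lemma cintegral_swap (H : R -> R -> R[i]) (h1 h2 : R -> R) :
  measurable_fun [set: TR * TR] (fun z => cRe (H z.1 z.2)) ->
  measurable_fun [set: TR * TR] (fun z => cIm (H z.1 z.2)) -> rint h1 -> rint h2 ->
  (forall t s, `|cRe (H t s)| <= h1 t * h2 s) -> (forall t s, `|cIm (H t s)| <= h1 t * h2 s) ->
  cintegral (fun t => cintegral (fun s => H t s)) = cintegral (fun s => cintegral (fun t => H t s)).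
Proof.
move=> m1 m2 i1 i2 b1 b2; rewrite /cintegral; apply: complex_ext => /=.
- exact: (Rint_swap m1 i1 i2 b1).
- exact: (Rint_swap m2 i1 i2 b2).
Qed.

Lemma measurable_complexM d (T : measurableType d) (F G : T -> R[i]) :
  measurable_fun [set: T] (fun z => cRe (F z)) -> measurable_fun [set: T] (fun z => cIm (F z)) ->
  measurable_fun [set: T] (fun z => cRe (G z)) -> measurable_fun [set: T] (fun z => cIm (G z)) ->
  measurable_fun [set: T] (fun z => cRe (F z * G z)) /\
  measurable_fun [set: T] (fun z => cIm (F z * G z)).
Proof.
move=> F1 F2 G1 G2; split.
- by under eq_fun do rewrite cReM; apply: measurable_funB; exact: measurable_funM.
- by under eq_fun do rewrite cImM; apply: measurable_funD; exact: measurable_funM.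
Qed.

(** A norm that bounds both components at once and is submultiplicative up to a factor 2, which
    suffices for the domination in Fubini's theorem. *)
Definition sumnorm (z : R[i]) : R := `|cRe z| + `|cIm z|.

Lemma sumnorm_ge0 z : 0 <= sumnorm z. Proof. by rewrite addr_ge0. Qed.
Lemma Re_le_sumnorm z : `|cRe z| <= sumnorm z. Proof. by rewrite lerDl. Qed.
Lemma Im_le_sumnorm z : `|cIm z| <= sumnorm z. Proof. by rewrite lerDr. Qed.
Lemma sumnormM z c : sumnorm (z * c) <= 2 * (sumnorm z * sumnorm c).
Proof.
rewrite /sumnorm cReM cImM.
have h1 := ler_normB (cRe z * cRe c) (cIm z * cIm c).
have h2 := ler_normD (cRe z * cIm c) (cIm z * cRe c).
rewrite !normrM in h1 h2.
have : 0 <= (`|cRe z| + `|cIm z|) * (`|cRe c| + `|cIm c|) by rewrite mulr_ge0// addr_ge0.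
lra.
Qed.
Lemma sumnorm_cexpi x : sumnorm (cexpi x) <= 2.
Proof. by rewrite /sumnorm/=; have := cos_max x; have := sin_max x; lra. Qed.
Lemma sumnorm_conj z : sumnorm z^*%C = sumnorm z.
Proof. by rewrite /sumnorm cRe_conj cIm_conj normrN. Qed.

(** Conjugating the kernel exp(i s t) and exchanging the integrals gives the forward transform of f,
    which is the inverse transform evaluated at - s. *)
Lemma inverse_fourier_adjoint f g : tame f -> tame g ->
  L2dot f (inverse_fourier g) = L2dot (fun s => inverse_fourier f (- s)) g.
Proof.
move=> tf tg; rewrite /L2dot.
pose H t s := c0 * f t * (g s)^*%C * cexpi (- (s * t)).
have tf' := tameZ c0 tf.
have [h1 i1 fh] := tame_majorant tf'; have [h2 i2 gh] := tame_majorant tg.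
have [[mf1 mf2] _ _] := tf'; have [[mg1 mg2] _ _] := tg.
have mst : measurable_fun [set: TR * TR] (fun z => - (z.2 * z.1)).
  by apply: measurable_funN; apply: measurable_funM.
have me : measurable_fun [set: TR * TR] (fun z => cRe (cexpi (- (z.2 * z.1)))) /\
          measurable_fun [set: TR * TR] (fun z => cIm (cexpi (- (z.2 * z.1)))).
  by split; apply: measurableT_comp mst; apply: continuous_measurable_fun;
    [exact: continuous_cos|exact: continuous_sin].
have m1 : measurable_fun [set: TR * TR] (fun z => cRe (c0 * f z.1)).
  exact: (measurableT_comp mf1 measurable_fst).
have m2 : measurable_fun [set: TR * TR] (fun z => cIm (c0 * f z.1)).
  exact: (measurableT_comp mf2 measurable_fst).
have m3 : measurable_fun [set: TR * TR] (fun z => cRe (g z.2)).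
  exact: (measurableT_comp mg1 measurable_snd).
have m4 : measurable_fun [set: TR * TR] (fun z => cIm (g z.2)).
  exact: (measurableT_comp mg2 measurable_snd).
have m5 : measurable_fun [set: TR * TR] (fun z => cRe (g z.2)^*%C).
  by under eq_fun do rewrite cRe_conj.
have m6 : measurable_fun [set: TR * TR] (fun z => cIm (g z.2)^*%C).
  by under eq_fun do rewrite cIm_conj; exact: measurable_funN.
have [m7 m8] := measurable_complexM m1 m2 m5 m6.
have [mH1 mH2] := measurable_complexM m7 m8 me.1 me.2.
(* The factor 8 collects a 2 from each of the two products and a 2 from the exponential. *)
have bnd t s : sumnorm (H t s) <= 8 * h1 t * h2 s.
  apply: le_trans (sumnormM _ _) _.
  have := sumnormM (c0 * f t) (g s)^*%C; rewrite sumnorm_conj.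
  have [h1t _] := fh t; have [h2s _] := gh s.
  rewrite -/(sumnorm _) in h1t; rewrite -/(sumnorm _) in h2s.
  have := sumnorm_cexpi (- (s * t)).
  have := ler_pM (sumnorm_ge0 _) (sumnorm_ge0 _) h1t h2s.
  have := sumnorm_ge0 (c0 * f t * (g s)^*%C); have := sumnorm_ge0 (cexpi (- (s * t))).
  move: (sumnorm (c0 * f t * _)) (sumnorm (cexpi _)) (sumnorm _ * sumnorm _) => a b c a0 b0.
  have h12 : 8 * h1 t * h2 s = 8 * (h1 t * h2 s) by rewrite mulrA.
  rewrite h12; move: (h1 t * h2 s) => d cd b2 ac.
  have : a * b <= a * 2 by rewrite ler_wpM2l.
  lra.
transitivity (cintegral (fun t => cintegral (fun s => H t s))).
  apply: eq_cintegral => t; rewrite /inverse_fourier -/c0 conjc_realM -/c0.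
  rewrite -cintegral_conj; last exact: tame_inverse_fourier_cint.
  rewrite mulrA -cintegralZ; last by apply: cint_conj; exact: tame_inverse_fourier_cint.
  by apply: eq_cintegral => s; rewrite conjcM cexpi_conj /H; ring.
rewrite (cintegral_swap mH1 mH2 (rintZ 8 i1) i2).
- apply: eq_cintegral => s; rewrite /inverse_fourier -/c0 [RHS]mulrAC.
  rewrite -cintegralZ; last exact: tame_inverse_fourier_cint.
  by apply: eq_cintegral => t; rewrite /H mulrN (mulrC s t); ring.
- by move=> t s; apply: le_trans (bnd t s); exact: Re_le_sumnorm.
- by move=> t s; apply: le_trans (bnd t s); exact: Im_le_sumnorm.
Qed.
End Plancherel.

(** * Tilings *)

Section Truncation.
Context {R : realType}.
Local Notation mu := (@lebesgue_measure R).
Local Notation TR := (measurableTypeR R).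

(** f is cut to [- n, n] and to the points where its squared modulus is at most n. At each point the
    truncations eventually equal f, and the squared error is dominated by [nsq] of f. *)
Lemma tame_dense (f : R -> R[i]) : L2 f -> forall eps : R, 0 < eps ->
  exists2 g, tame g & nrm2 (fun t => f t - g t) < eps.
Proof.
move=> fL eps eps0; have mf := L2_cmeas fL.
pose A (n : nat) : set R := `[- n%:R, n%:R]%classic `&` [set t | nsq (f t) <= n%:R].
have mA n : measurable (A n : set TR).
  apply: measurableI; first exact: measurable_itv.
  rewrite -[X in measurable X]setTI.
  have := measurable_nsq mf measurableT (@measurable_itv R `]-oo, n%:R]).
  by rewrite set_itvE; exact.
pose G n t : R[i] := (\1_(A n) t)%:C * f t.
have GE n t : nsq (f t - G n t) = (1 - \1_(A n) t) ^+ 2 * nsq (f t).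
  by rewrite -[X in nsq (X - _)]mul1r -mulrBl nsqM -(rmorph1 (real_complex R)) -rmorphB nsq_real.
have mG n : cmeas (G n) by apply: cmeasM => //; exact: cmeas_indic.
have [||n Hn] := @nrm2_dominated _ G f _ mG mf (L2_rint fL) _ _ _ eps0.
- move=> n t; rewrite GE ler_piMl ?nsq_ge0// indicE; case: (_ \in _);
    by rewrite ?mulr1n ?mulr0n ?subrr ?subr0 ?expr1n ?expr0n.
- apply: aeW => t; apply: cvg_near_cst.
  exists (Num.bound (`|t| + nsq (f t))) => // n /= Nn.
  rewrite GE indicE mem_set ?subrr ?expr0n ?mul0r//.
  have tn : `|t| + nsq (f t) <= n%:R.
    have p0 : 0 <= `|t| + nsq (f t) by rewrite addr_ge0// nsq_ge0.
    by apply: le_trans (ltW (archi_boundP p0)) _; rewrite ler_nat.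
  have := nsq_ge0 (f t); have := normr_ge0 t => t0 f0.
  by split => /=; [rewrite in_itv/= -ler_norml; lra|lra].
exists (G n) => //; split => //.
- exists n%:R => t; rewrite nsq_indicM indicE; case: (boolP (t \in A n)) => tA.
    by rewrite mul1r; move: tA; rewrite inE => -[].
  by rewrite mul0r.
- exists n%:R => t tn; rewrite /G indicE memNset ?mul0r// => -[/=].
  by rewrite in_itv/= -ler_norml leNgt tn.
Qed.

End Truncation.

(** * Exact tilings and the transfer of integrals to the circle *)

Section Unfolding.
Context {R : realType} (E : set R).
Local Notation mu := (@lebesgue_measure R).
Local Notation TR := (measurableTypeR R).

Definition translation_tiling : Prop :=
  (forall x, exists k : int, E (x + 2 * k%:~R * pi)) /\
  (forall x (j k : int), E (x + 2 * j%:~R * pi) -> E (x + 2 * k%:~R * pi) -> j = k).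

(** The uniqueness clause also covers x = 0, where it forces 0 to lie outside E. *)
Definition dyadic_tiling : Prop :=
  (forall x, x != 0 -> exists n : int, E ((2 : R) ^ (- n) * x)) /\
  (forall x (m n : int), E ((2 : R) ^ (- m) * x) -> E ((2 : R) ^ (- n) * x) -> m = n).

Hypothesis mE : measurable (E : set TR).
Hypothesis tE : translation_tiling.

Let tau := translation_map E.

Lemma translation_mapP x (k : int) : E (x + 2 * k%:~R * pi) -> tau x = x + 2 * k%:~R * pi.
Proof.
move=> Ek; rewrite /tau /translation_map; congr (_ + 2 * _%:~R * _).
by apply: (tE.2 x) => //; apply: (@xgetPex _ 0 [set n : int | E (x + 2 * n%:~R * pi)]); exists k.
Qed.

Lemma translation_mapE x : exists2 k : int, tau x = x + 2 * k%:~R * pi & E (tau x).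
Proof. by have [k Ek] := tE.1 x; exists k; rewrite (translation_mapP Ek). Qed.

(** The preimage of A is the countable union over k of the points x with x + 2 k pi in both E and
    A. *)
Lemma measurable_translation_map : measurable_fun [set: TR] (tau : TR -> TR).
Proof.
move=> _ A mA; rewrite setTI.
rewrite (_ : tau @^-1` A = \bigcup_n
   [set x | (E `&` A) (x + 2 * (int_of_nat n)%:~R * pi)]).
  apply: bigcupT_measurable => n.
  rewrite -[X in measurable X]setTI.
  have mt : measurable_fun [set: TR] (fun x : TR => x + 2 * (int_of_nat n)%:~R * pi : TR).
    by apply: measurable_funD => //; exact: measurable_cst.
  by apply: mt => //; exact: measurableI.
apply/seteqP; split => x /=.
  have [k tk Et] := translation_mapE x => At.
  have [_ _ /(_ k I)[n _ nk]] := int_of_nat_bij.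
  by exists n => //; rewrite /= nk -tk.
by move=> [n _ [En An]]; rewrite (translation_mapP En).
Qed.

Lemma circle_translate (x : R) : exists k : int, circle (x + k%:~R * (2 * pi)).
Proof.
have p0 := @two_pi_gt0 R.
exists (- Num.floor ((x + pi) / (2 * pi))).
rewrite /circle/= in_itv/= intrN mulNr.
have := floor_itv ((x + pi) / (2 * pi)); rewrite intrD ler_pdivlMr// ltr_pdivrMr//.
by move: (Num.floor _)%:~R => q; rewrite mulrDl mulr1z mul1r; set r := q * (2 * pi); lra.
Qed.

Lemma circle_translate_uniq (x : R) (j k : int) :
  circle (x + j%:~R * (2 * pi)) -> circle (x + k%:~R * (2 * pi)) -> j = k.
Proof.
have p0 := @two_pi_gt0 R.
rewrite /circle/= !in_itv/= => hj hk.
have : (j - k)%:~R * (2 * pi) < 1 * (2 * pi) :> R by rewrite intrB mulrBl; lra.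
have : (k - j)%:~R * (2 * pi) < 1 * (2 * pi) :> R by rewrite intrB mulrBl; lra.
rewrite !ltr_pM2r// !(ltr_int R _ 1) => kj jk; lia.
Qed.

(** When the line is folded onto [circle], the only translate of x that contributes is the one in E,
    namely [tau x]. *)
Lemma integral_unfold (h : R -> \bar R) : measurable_fun [set: TR] h ->
  (forall x, ~ E x -> h x = 0%E) ->
  (\int[mu]_x h x = \int[mu]_(x in circle) h (tau x))%E.
Proof.
move=> mh hE.
have ge0 (g : R -> \bar R) : measurable_fun [set: TR] g -> (forall x, ~ E x -> g x = 0%E) ->
    (forall x, 0 <= g x)%E -> (\int[mu]_x g x = \int[mu]_(x in circle) g (tau x))%E.
  move=> mg gE g0.
  rewrite (@ge0_integral_translates _ circle (2 * pi))//.
  - apply: eq_integral => x _; have [k tk Et] := translation_mapE x.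
    (* The folded sum runs over x - j (2 pi), so the shift by k in [tau x] appears at the index -
       k. *)
    rewrite (@esum_int1 _ _ (- k)).
    + by rewrite tk intrN mulNr opprK mulrA (mulrC k%:~R).
    + by move=> j; exact: g0.
    + move=> j /eqP jk; apply: gE => Ej; apply: jk.
      apply: oppr_inj; rewrite opprK; apply: (tE.2 x); last by rewrite -tk.
      by move: Ej; rewrite intrN mulrN mulNr mulrA (mulrC j%:~R).
  - exact: measurable_circle.
  - exact: circle_translate.
  - exact: circle_translate_uniq.
rewrite integralE [RHS]integralE.
rewrite (ge0 h^\+)%E//; [|exact: measurable_funepos|
  by move=> x /hE; rewrite funeposE => ->; rewrite maxxx].
rewrite (ge0 h^\-)%E//; [|exact: measurable_funeneg|
  by move=> x /hE; rewrite funenegE => ->; rewrite oppe0 maxxx].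
have hT : (fun x => h (tau x)) = h \o tau by [].
by rewrite [in RHS]hT [in RHS](funepos_comp h) [in RHS](funeneg_comp h).
Qed.

Lemma rint_unfold (h : R -> R) : rint h -> (forall x, ~ E x -> h x = 0) ->
  rint (fun x => \1_circle x * h (tau x)) /\
  \int[mu]_x h x = \int[mu]_x (\1_circle x * h (tau x)).
Proof.
move=> ih hE; have mh := rint_cmeas ih.
have mh' : measurable_fun [set: TR] (EFin \o h) by exact/measurable_EFinP.
have mht : measurable_fun [set: TR] (fun x => h (tau x)).
  exact: (measurableT_comp mh measurable_translation_map).
have pE (g : R -> R) : (\int[mu]_(x in circle) (g x)%:E = \int[mu]_x (\1_circle x * g x)%:E)%E.
  rewrite integral_mkcond; apply: eq_integral => x _.
  by rewrite patchE indicE; case: (_ \in _); rewrite ?mul1r ?mul0r.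
split; last first.
  rewrite /Rintegral -(pE (h \o tau)); congr fine.
  by rewrite integral_unfold// => x /hE /= ->.
apply/integrableP; split.
  apply/measurable_EFinP; apply: measurable_funM => //.
  by apply: measurable_indic; exact: measurable_circle.
move/integrableP : ih => [_]; rewrite integral_unfold//; last first.
- by move=> x /hE /= ->; rewrite normr0.
- exact: measurableT_comp.
apply: le_lt_trans; rewrite (pE (fun x => `|h (tau x)|)) le_eqVlt; apply/orP; left.
apply/eqP/eq_integral => x _ /=; congr EFin.
by rewrite normrM ger0_norm//; case/andP: (indic_itv01 circle x).
Qed.

Lemma cint_unfold (h : R -> R[i]) : cint h -> (forall x, ~ E x -> h x = 0) ->
  cint (fun x => (\1_circle x)%:C * h (tau x)) /\
  cintegral h = cintegral (fun x => (\1_circle x)%:C * h (tau x)).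
Proof.
move=> [h1 h2] hE.
have [i1 e1] := rint_unfold h1 (fun x Ex => congr1 (@complex.Re R) (hE x Ex)).
have [i2 e2] := rint_unfold h2 (fun x Ex => congr1 (@complex.Im R) (hE x Ex)).
split; first split.
- by apply: eq_rint i1 => x; rewrite cReM/= mul0r subr0.
- by apply: eq_rint i2 => x; rewrite cImM/= mul0r addr0.
rewrite /cintegral; apply: complex_ext => /=.
- by rewrite e1; apply: eq_Rintegral => x _; rewrite cReM/= mul0r subr0.
- by rewrite e2; apply: eq_Rintegral => x _; rewrite cImM/= mul0r addr0.
Qed.

Lemma L2_unfold (h : R -> R[i]) : L2 h -> (forall x, ~ E x -> h x = 0) ->
  L2 (fun x => (\1_circle x)%:C * h (tau x)) /\
  nrm2 h = nrm2 (fun x => (\1_circle x)%:C * h (tau x)).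
Proof.
move=> /L2P[mh ih] hE.
have [|i e] := rint_unfold ih; first by move=> x /hE ->; rewrite nsq0.
split.
  apply/L2P; split.
    apply: cmeasM; first by apply: cmeas_indic; exact: measurable_circle.
    by apply: (cmeas_comp measurable_translation_map mh).
  by apply: eq_rint i => x; rewrite nsq_indicM.
by rewrite /nrm2 e; apply: eq_Rintegral => x _; rewrite nsq_indicM.
Qed.

Lemma mu_tile : mu E = (2 * pi)%:E.
Proof.
rewrite -(mu_circle (R := R)) -[LHS]mul1e -[RHS]mul1e.
transitivity (\int[mu]_x (\1_E x)%:E)%E; first by rewrite integral_indic// setIT mul1e.
rewrite integral_unfold//.
- rewrite -integral_cst; last exact: measurable_circle.
  by apply: eq_integral => x _; have [k _ Et] := translation_mapE x; rewrite indicE mem_set.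
- by apply/measurable_EFinP; exact: measurable_indic.
- by move=> x nE; rewrite indicE memNset.
Qed.

End Unfolding.

(** * Exact tilings give wavelet sets *)

Section WaveletSet.
Context {R : realType} (E : set R).
Local Notation mu := (@lebesgue_measure R).
Local Notation TR := (measurableTypeR R).
Hypothesis mE : measurable (E : set TR).
Hypothesis bE : exists B : R, forall x, E x -> `|x| <= B.
Hypothesis tE : translation_tiling E.
Hypothesis dE : dyadic_tiling E.

Local Notation tau := (translation_map E).
Local Notation s2pi := (Num.sqrt (2 * pi) : R).

(** The normalized indicator of E, with the measure 2 pi supplied by [mu_tile] already inserted. *)
Let w (s : R) : R[i] := (\1_E s / s2pi)%:C.
Let q (n : int) : R := (2 : R) ^ n.
Let r (n : int) : R := (2 : R) `^ (n%:~R / 2).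

Let q_gt0 n : 0 < q n. Proof. by rewrite exprz_gt0. Qed.
Let q_neq0 n : q n != 0. Proof. by rewrite gt_eqF. Qed.
Let qV_neq0 n : (q n)^-1 != 0. Proof. by rewrite invr_eq0. Qed.
Let qV n x : (2 : R) ^ (- n) * x = (q n)^-1 * x. Proof. by rewrite /q invr_expz. Qed.
Let rr n : r n ^+ 2 = q n.
Proof.
rewrite expr2 /r -powRD ?pnatr_eq0 ?implybT//.
rewrite (_ : n%:~R / 2 + n%:~R / 2 = n%:~R :> R); last by field.
by rewrite powR_intmul.
Qed.
Let s2pi_gt0 : 0 < s2pi. Proof. by rewrite sqrtr_gt0 two_pi_gt0. Qed.

Let tame_w : tame w.
Proof.
have [B EB] := bE; split.
- by apply: cmeas_real; apply: measurable_funM => //; exact: measurable_indic.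
- exists (s2pi^-1 ^+ 2) => t; rewrite nsq_real exprMn ler_piMl ?sqr_ge0//.
- exists B => t Bt; rewrite /w indicE memNset ?mul0r// => /EB.
  by rewrite leNgt Bt.
Qed.

Let wE x : ~ E x -> w x = 0.
Proof. by move=> nE; rewrite /w indicE memNset// mul0r. Qed.

(* The transform of [dyadic_translate psi (n, l)]. *)
Let wav (n l : int) (s : R) : R[i] :=
  (r n / q n)%:C * (cexpi (- (l%:~R * ((q n)^-1 * s))) * w ((q n)^-1 * s)).

Let tame_wav n l : tame (wav n l).
Proof.
apply: tameZ; apply: tame_cexpi.
  by apply: measurable_funN; apply: measurable_funM => //; exact: mulrl_measurable.
by apply: eq_tame (tame_affine (qV_neq0 n) tame_w) => s; rewrite /= /affine addr0.
Qed.

Let cint_exp_wav t n l :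
  cint (fun s => cexpi (s * t) * (cexpi (- (l%:~R * ((q n)^-1 * s))) * w ((q n)^-1 * s))).
Proof.
apply: tame_inverse_fourier_cint; apply: tame_cexpi.
  by apply: measurable_funN; apply: measurable_funM => //; exact: mulrl_measurable.
by apply: eq_tame (tame_affine (qV_neq0 n) tame_w) => s; rewrite /= /affine addr0.
Qed.

(** Under s -> 2^n s the modulation in [wav n l] becomes the translation by l, and the Jacobian 2^n
    cancels the denominator of [r n / q n]. *)
Lemma dyadic_translate_inverse_fourier n l :
  dyadic_translate (inverse_fourier w) (n, l) = inverse_fourier (wav n l).
Proof.
apply/funext => t; rewrite /dyadic_translate/= -/(q n) -/(r n).
have -> : inverse_fourier (wav n l) t = (r n / q n)%:C * inverse_fourier
    (fun s => cexpi (- (l%:~R * ((q n)^-1 * s))) * w ((q n)^-1 * s)) t.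
  rewrite -inverse_fourierZ//; apply: tame_cexpi.
    by apply: measurable_funN; apply: measurable_funM => //; exact: mulrl_measurable.
  by apply: eq_tame (tame_affine (qV_neq0 n) tame_w) => s; rewrite /= /affine addr0.
rewrite {2}/inverse_fourier (cintegral_affine 0 (q_neq0 n)); last exact: cint_exp_wav.
rewrite gtr0_norm// /inverse_fourier [RHS]mulrCA [LHS]mulrCA; congr (_ * _).
rewrite mulrA -rmorphM mulfVK//; congr (_ * _); apply: eq_cintegral => s /=.
rewrite /affine addr0 mulKf// mulrA -cexpiD; congr (cexpi _ * _); ring.
Qed.

(** Different scales have disjoint supports. At equal scales the product is moved to E and folded
    onto [circle]; integer frequencies do not see translations by 2 pi, so the orthogonality of the
    exponentials applies. *)
Let wav_orthonormal n l m k : L2dot (wav n l) (wav m k) = ((n, l) == (m, k))%:R.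
Proof.
rewrite xpair_eqE; have [<-{m}|nm] := eqVneq n m; last first.
  rewrite -[RHS](L2dot0l (L2_tame tame_w)); apply: eq_cintegral => s; rewrite /wav mul0r.
  have [En|nEn] := pselect (E ((q n)^-1 * s)); last by rewrite wE// !mulr0 mul0r.
  have [Em|nEm] := pselect (E ((q m)^-1 * s)); last by rewrite (wE nEm) !mulr0 rmorph0 mulr0.
  by move/eqP: nm => []; apply: (dE.2 s); rewrite qV.
pose H u : R[i] := cexpi ((k - l)%:~R * u) * (\1_E u / (2 * pi))%:C.
have tH : tame H.
  apply: tame_cexpi; first exact: mulrl_measurable.
  apply: eq_tame (tameZ (s2pi^-1)%:C tame_w) => u; rewrite /w -rmorphM; congr (_%:C).
  by rewrite mulrCA -expr2 exprVn sqr_sqrtr// ltW// two_pi_gt0.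
transitivity (cintegral H).
  rewrite (cintegral_affine 0 (qV_neq0 n) (cint_tame tH)) gtr0_norm ?invr_gt0//.
  rewrite -cintegralZ; last by apply: cint_affine => //; exact: cint_tame.
  apply: eq_cintegral => s; rewrite /wav /H /= /affine addr0.
  set u := (q n)^-1 * s.
  rewrite intrB mulrBl cexpiD -cexpi_conj.
  rewrite [in RHS](_ : (q n)^-1 = (r n / q n) ^+ 2); last first.
    by rewrite exprMn rr expr2 mulVKf.
  have -> : \1_E u / (2 * pi) = (\1_E u / s2pi) ^+ 2 :> R.
    rewrite exprMn exprVn sqr_sqrtr ?(ltW two_pi_gt0)//; congr (_ / _).
    by rewrite indicE; case: (_ \in _); rewrite ?expr1n ?expr0n.
  rewrite /w; move: (r n / q n) (\1_E u / s2pi) => a b.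
  by apply: complex_ext; rewrite !ReImE/= ?cosN ?sinN; ring.
have HE x : ~ E x -> H x = 0 by move=> nE; rewrite /H indicE memNset// mul0r mulr0.
have [_ ->] := cint_unfold mE tE (cint_tame tH) HE.
rewrite (@eq_cintegral _ _ (fun x => ((2 * pi)^-1)%:C *
    ((\1_circle x)%:C * cexpi ((k - l)%:~R * x)))); last first.
  move=> x; have [j tj Et] := translation_mapE tE x.
  rewrite /H (_ : \1_E (tau x) = 1) ?div1r; last by rewrite indicE mem_set.
  rewrite tj mulrDr.
  rewrite (_ : (k - l)%:~R * (2 * j%:~R * pi) = 2 * ((k - l) * j)%:~R * pi); last first.
    by rewrite intrM; ring.
  by rewrite cexpi_pi_int; ring.
rewrite cintegralZ; last first.
  apply: cint_indic_cexpi; [exact: measurable_circle|by rewrite mu_circle ltry|].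
  exact: measurable_mull.
rewrite cintegral_circle_cexpi subr_eq0 -rmorphM mulrA mulVf; last by rewrite gt_eqF// two_pi_gt0.
by rewrite mul1r rmorph_nat eq_sym.
Qed.

Let slice (n : int) (F : R -> R[i]) (s : R) : R[i] := (\1_E ((q n)^-1 * s))%:C * F s.

Let L2_slice n F : L2 F -> L2 (slice n F).
Proof.
apply: (@L2_bounded_mul _ _ _ 1).
- apply: (@cmeas_comp _ (fun s => (\1_E s)%:C) (fun s => (q n)^-1 * s)).
    exact: mulrl_measurable.
  exact: cmeas_indic.
- move=> s; rewrite nsq_real exprn_ile1//; by case/andP: (indic_itv01 E ((q n)^-1 * s)).
Qed.

(** The part of F on 2^n E is pulled back to E and folded onto [circle], where its coefficients
    along [wav n l] become Fourier coefficients and Parseval's identity holds. *)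
Let slice_energy n F : L2 F ->
  (\esum_(l in [set: int]) (nsq (L2dot F (wav n l)))%:E = (nrm2 (slice n F))%:E)%E.
Proof.
move=> FL.
have FqL : L2 (F \o affine (q n) 0) by exact: L2_affine.
pose Phi0 u : R[i] := (r n)%:C * (w u * (F \o affine (q n) 0) u).
have Phi0L : L2 Phi0.
  have [mw [B wB] _] := tame_w.
  by apply: L2Z; exact: L2_bounded_mul mw wB FqL.
have Phi0E x : ~ E x -> Phi0 x = 0 by move=> /wE wx; rewrite /Phi0 wx mul0r mulr0.
pose Phi x : R[i] := (\1_circle x)%:C * Phi0 (tau x).
have [PhiL PhiN] := L2_unfold mE tE Phi0L Phi0E.
have coeff l : L2dot F (wav n l) = cintegral (fun x => Phi x * cexpi (- ((- l)%:~R * x))).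
  rewrite /L2dot (cintegral_affine 0 (q_neq0 n)); last first.
    by apply: cint_dot => //; exact: L2_tame.
  have eL : L2 (fun u => cexpi (l%:~R * u) * ((r n)%:C * (F \o affine (q n) 0) u)).
    apply: (@L2_bounded_mul _ _ _ 1).
    - by apply: cmeas_cexpi; exact: mulrl_measurable.
    - by move=> t; rewrite nsq_cexpi.
    - exact: L2Z.
  have ci : cint (fun u => Phi0 u * cexpi (l%:~R * u)).
    by apply: eq_cint (cint_L2M (L2_tame tame_w) eL) => u; rewrite /Phi0; ring.
  transitivity (cintegral (fun u => Phi0 u * cexpi (l%:~R * u))).
    rewrite gtr0_norm// -cintegralZ; last first.
      by apply: cint_affine => //; apply: cint_dot => //; exact: L2_tame.
    apply: eq_cintegral => u; rewrite /Phi0 /wav /comp /affine addr0 mulKf//.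
    rewrite conjc_realM conjcM cexpi_conj opprK /w.
    rewrite [in RHS](_ : r n = q n * (r n / q n)); last by rewrite mulrCA mulfV// mulr1.
    move: (r n / q n) (q n) (\1_E u / s2pi) (F _) (cexpi _) => a b x y z.
    by apply: complex_ext; rewrite !ReImE/=; ring.
  have ciE x : ~ E x -> Phi0 x * cexpi (l%:~R * x) = 0 by move=> /Phi0E ->; rewrite mul0r.
  have [_ ->] := cint_unfold mE tE ci ciE; apply: eq_cintegral => x.
  have [j tj Et] := translation_mapE tE x.
  rewrite mulrA; congr (_ * _); rewrite intrN mulNr opprK tj mulrDr.
  rewrite (_ : l%:~R * (2 * j%:~R * pi) = 2 * (l * j)%:~R * pi); last by rewrite intrM; ring.
  by rewrite cexpi_pi_int.
(* Conjugating [wav n l] produces exp(i l x), whereas [circle_parseval] has exp(- i k x); the sum is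
   reindexed by k = - l. *)
have opp_bij : set_bij [set: int] [set: int] (fun l : int => - l).
  by split.
under eq_esum do rewrite coeff.
rewrite -(@reindex_esum _ _ _ _ _ _ (fun k : int =>
   (nsq (cintegral (fun x => Phi x * cexpi (- (k%:~R * x)))))%:E) opp_bij).
rewrite (circle_parseval PhiL); last by move=> t tD; rewrite indicE memNset// mul0r.
rewrite -PhiN; congr EFin.
rewrite (nrm2_affine 0 (q_neq0 n) (L2_slice n FL)) gtr0_norm//.
have : 2 * pi * nrm2 Phi0 = nrm2 (fun u => (s2pi * r n)%:C * (w u * (F \o affine (q n) 0) u)).
  rewrite [RHS](@eq_nrm2 _ _ (fun u => s2pi%:C * Phi0 u)); last first.
    by move=> u; rewrite /Phi0 rmorphM -mulrA.
  by rewrite nrm2Z// nsq_real sqr_sqrtr// ltW// two_pi_gt0.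
move=> ->.
have qE : q n = nsq (r n)%:C by rewrite nsq_real rr.
rewrite [X in _ = X * _]qE -nrm2Z; last by apply: L2_affine => //; exact: L2_slice.
apply: eq_nrm2 => u; rewrite /slice /= /affine addr0 mulKf// !mulrA -!rmorphM; congr (_%:C * _).
by field; rewrite gt_eqF.
Qed.

(** Off the null set {0}, each point lies in exactly one dilate of E, so exactly one slice carries
    the value of F there. *)
Let slices_energy F : L2 F ->
  (\esum_(n in [set: int]) (nrm2 (slice n F))%:E = (nrm2 F)%:E)%E.
Proof.
move=> FL.
under eq_esum => n _ do rewrite (nrm2E (L2_slice n FL)).
rewrite -integral_esum_int//; last 2 first.
- move=> n; apply/measurable_EFinP; exact: measurable_nsq (L2_cmeas (L2_slice n FL)).
- by move=> n x; rewrite lee_fin nsq_ge0.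
rewrite nrm2E//; apply: ae_eq_integral => //.
- rewrite (_ : (fun x => _) = fun x => (\sum_(n <oo) (nsq (slice (int_of_nat n) F x))%:E)%E).
    apply: ge0_emeasurable_sum => [n x _ _|n _]; first by rewrite lee_fin nsq_ge0.
    by apply/measurable_EFinP; exact: measurable_nsq (L2_cmeas (L2_slice _ FL)).
  by apply/funext => x; rewrite esum_int// => k; rewrite lee_fin nsq_ge0.
- by apply/measurable_EFinP; exact: measurable_nsq (L2_cmeas FL).
exists [set 0]; split => //; first exact: lebesgue_measure_set1.
move=> x; apply: contra_notP => /eqP x0 _.
have [n En] := dE.1 x x0.
rewrite (@esum_int1 _ _ n).
- by rewrite /slice nsq_indicM indicE mem_set ?mul1r// -qV.
- by move=> k; rewrite lee_fin nsq_ge0.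
- move=> k /eqP kn; rewrite /slice nsq_indicM indicE memNset ?mul0r// -qV => Ek.
  by apply: kn; exact: dE.2 Ek En.
Qed.

(** For completeness, the wavelet coefficients of a tame f1 are those of its Fourier transform along
    the [wav n l], by [inverse_fourier_adjoint]. Summing over l, then over n, gives Parseval's
    identity for f1, hence its approximation by projections; density of tame functions does the
    rest. *)
Theorem tiling_wavelet_set : wavelet_set E.
Proof.
have muE := mu_tile mE tE.
split => //; first by rewrite muE lte_fin two_pi_gt0/=; exact: ltry.
have -> : (fun s => (\1_E s / Num.sqrt (fine (mu E)))%:C) = w by rewrite muE.
pose e (i : int * int) := wav i.1 i.2.
have DE i : dyadic_translate (inverse_fourier w) i = inverse_fourier (e i).
  by case: i => n l; exact: dyadic_translate_inverse_fourier.
split; first exact: L2_inverse_fourier.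
split.
- by move=> i; rewrite DE; exact: L2_inverse_fourier (tame_wav _ _).
- move=> [n l] [m k]; rewrite !DE plancherel_dot ?wav_orthonormal//; exact: tame_wav.
move=> f fL eps eps0.
(* Two squared errors below this bound, each doubled by [nrm2D_le], stay below eps^2. *)
have e2 : 0 < eps ^+ 2 / 4 by rewrite divr_gt0// exprn_gt0.
have [f1 tf1 ff1] := tame_dense fL e2.
have f1L := L2_tame tf1.
pose u i := dyadic_translate (inverse_fourier w) i.
have uL i : L2 (u i) by rewrite /u DE; exact: L2_inverse_fourier (tame_wav _ _).
have uO i j : L2dot (u i) (u j) = (i == j)%:R.
  by case: i j => [n l] [m k]; rewrite /u !DE plancherel_dot ?wav_orthonormal//; exact: tame_wav.
have N1 : (-1 : R) != 0 by rewrite oppr_eq0 oner_eq0.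
(* F is the forward Fourier transform of f1. *)
pose F s := inverse_fourier f1 (- s).
have FE : F = inverse_fourier f1 \o affine (-1) 0.
  by apply/funext => s; rewrite /F /= /affine addr0 mulN1r.
have FL : L2 F by rewrite FE; apply: L2_affine => //; exact: L2_inverse_fourier.
have FN : nrm2 F = nrm2 f1.
  rewrite -(plancherel tf1) (nrm2_affine 0 N1 (L2_inverse_fourier tf1)) -FE.
  by rewrite normrN normr1 mul1r.
have energy : (\esum_(i in [set: int * int]) (nsq (L2dot f1 (u i)))%:E = (nrm2 f1)%:E)%E.
  rewrite -FN -slices_energy//.
  under [RHS]eq_esum do rewrite -slice_energy//.
  rewrite esum_esum; last by move=> *; rewrite lee_fin nsq_ge0.
  rewrite (_ : _ `*`` _ = [set: int * int]); last by apply/seteqP; split.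
  apply: eq_esum => -[n l] _ /=; rewrite /u DE inverse_fourier_adjoint//.
  exact: tame_wav.
have [s Hs] := parseval_proj uL uO f1L energy e2.
exists s, (fun i => L2dot f1 (u i)).
apply: L2norm_lt => //.
  by apply: L2B => //; apply: L2_sum => i; exact: L2Z.
rewrite (@eq_nrm2 _ _ (fun t => (f t - f1 t) + (f1 t - proj u s f1 t))); last first.
  by move=> t; rewrite /proj; ring.
apply: le_lt_trans (nrm2D_le _ _) _.
- exact: L2B.
- by apply: L2B => //; exact: L2_proj.
- lra.
Qed.

End WaveletSet.

(** * The example *)

Section Dyadic.
Context {R : realType} (E : set R) (T : R -> bool).
Hypothesis Thalf : forall x, T x -> T (2^-1 * x).
Hypothesis T0 : exists2 d : R, 0 < d & forall x, `|x| < d -> T x.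
Hypothesis Tb : exists B : R, forall x, T x -> `|x| <= B.
Hypothesis ET : forall x, E x <-> T (2^-1 * x) && ~~ T x.

Lemma exp2z_half (n : int) (x : R) : (2 : R) ^ (- (n + 1)) * x = 2^-1 * (2 ^ (- n) * x).
Proof. by rewrite mulrA -exprN1 -expfzDr ?pnatr_eq0// opprD addrC. Qed.

Lemma dilates_mono (n : int) (k : nat) x :
  T ((2 : R) ^ (- n) * x) -> T ((2 : R) ^ (- (n + k%:Z)) * x).
Proof.
move=> Tn; elim: k => [|k IH]; first by rewrite addr0.
rewrite (_ : n + k.+1%:Z = n + k%:Z + 1); last by lia.
by rewrite exp2z_half; exact: Thalf.
Qed.

Lemma exp2_unbounded (a b : R) : 0 < a -> exists k : nat, b < 2 ^+ k * a.
Proof.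
move=> a0; exists (Num.bound (`|b| / a)).
rewrite -ltr_pdivrMr//; apply: le_lt_trans (_ : `|b| / a < _).
  by rewrite ler_pM2r ?invr_gt0// ler_norm.
apply: lt_trans (archi_boundP _) _; first by rewrite divr_ge0// ltW.
by rewrite -natrX ltr_nat ltn_expl.
Qed.

(** For x <> 0 the condition that 2^(- n) x lies in T is monotone in n, false for very negative n
    and true for large n. E contains 2^(- n) x exactly at the last n where it is false. *)
Lemma dyadic_tiling_of_scaling : dyadic_tiling E.
Proof.
split=> [x x0|x m n Em En].
  have [B TB] := Tb; have [d d0 dT] := T0.
  have nx0 : 0 < `|x| by rewrite normr_gt0.
  have [M HM] := exp2_unbounded B nx0.
  have [N HN] := exp2_unbounded `|x| d0.
  have TN : T ((2 : R) ^ (- N%:Z) * x).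
    apply: dT; rewrite normrM -invr_expz normfV [`|2 ^ _|]ger0_norm ?exprz_ge0//.
    by rewrite mulrC ltr_pdivrMr ?exprz_gt0// mulrC.
  have TM : ~~ T ((2 : R) ^ (- - M%:Z) * x).
    apply/negP => /TB; rewrite opprK normrM ger0_norm ?exprz_ge0//.
    by rewrite leNgt HM.
  have exi : exists i : nat, T ((2 : R) ^ (- (- M%:Z + i%:Z)) * x).
    by exists (M + N)%N; rewrite PoszD addKr.
  (* The least exponent with a dilate in T, counted from - M; it is not - M itself, and its
     predecessor is the required n. *)
  case: (ex_minnP exi) => [[|i]] Ti imin.
    by rewrite addr0 (negbTE TM) in Ti.
  exists (- M%:Z + i%:Z); apply/ET; rewrite -exp2z_half.
  rewrite -addrA -PoszD addn1 Ti /=; apply/negP => /imin.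
  by rewrite ltnn.
wlog mn : m n Em En / m <= n.
  by move=> W; case: (leP m n) => [|/ltW] h; [exact: W|apply/esym; exact: W].
move: mn; rewrite le_eqVlt => /predU1P[//|mn]; exfalso.
move/ET : Em => /andP[+ _]; move/ET : En => /andP[_ /negP nTn].
rewrite -exp2z_half => /(dilates_mono (absz (n - (m + 1))%R)).
by rewrite (_ : m + 1 + _ = n)//; lia.
Qed.

End Dyadic.

(** * Unions of cells of length pi / 21 *)

Section Grid.
Context {R : realType}.
Local Notation mu := (@lebesgue_measure R).
Local Notation TR := (measurableTypeR R).

(** Translation by 2 pi adds 42 to the index and halving a point halves its index, rounded down, so
    that tilings by unions of cells reduce to integer arithmetic. *)
Definition cell (x : R) : int := Num.floor (x * (21 / pi)).

Definition grid_set (P : int -> bool) : set R := [set x | P (cell x)].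

Lemma pi_neq0 : pi != 0 :> R. Proof. by rewrite gt_eqF// pi_gt0. Qed.

Lemma cell_translate (x : R) (k : int) : cell (x + 2 * k%:~R * pi) = cell x + 42 * k.
Proof.
rewrite /cell (_ : (x + _) * _ = x * (21 / pi) + (42 * k)%:~R); last first.
  by rewrite intrM; move: (pi : R) pi_neq0 => p p0; field.
by rewrite floorDrz ?intr_int// intrKfloor.
Qed.

Lemma cell_half (x : R) : cell (2^-1 * x) = (cell x %/ 2)%Z.
Proof.
have := floor_itv (x * (21 / pi)); rewrite -/(cell x) => h.
apply: floor_def; rewrite -mulrA.
have c1 : ((cell x %/ 2)%Z * 2)%:~R <= (cell x)%:~R :> R by rewrite ler_int; lia.
have c2 : (cell x + 1)%:~R <= (((cell x %/ 2)%Z + 1) * 2)%:~R :> R by rewrite ler_int; lia.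
rewrite !intrM in c1 c2; lra.
Qed.

Lemma cell_itv (x : R) (m : int) : cell x = m <-> m%:~R * (pi / 21) <= x < (m + 1)%:~R * (pi / 21).
Proof.
have p0 : 0 < pi / 21 :> R by rewrite divr_gt0// pi_gt0.
have E : x * (21 / pi) = x / (pi / 21) by move: (pi : R) pi_neq0 => p ?; field.
rewrite -ler_pdivlMr// -ltr_pdivrMr// -E; split => [<-|].
  exact: floor_itv.
exact: floor_def.
Qed.

Lemma measurable_grid_set (P : int -> bool) : measurable (grid_set P : set TR).
Proof.
rewrite (_ : grid_set P = \bigcup_n (if P (int_of_nat n) then
   `[(int_of_nat n)%:~R * (pi / 21), (int_of_nat n + 1)%:~R * (pi / 21)[%classic else set0)).
  by apply: bigcupT_measurable => n; case: ifP => _; [exact: measurable_itv|exact: measurable0].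
apply/seteqP; split => x /=.
  move=> Px; have [_ _ /(_ (cell x) I)[n _ nE]] := int_of_nat_bij.
  by exists n => //; rewrite nE ifT//= in_itv/=; exact/cell_itv.
by move=> [n _]; case: ifP => // Pn; rewrite /= in_itv/= => /cell_itv; rewrite /grid_set/= => ->.
Qed.

Lemma cell_bounded (x : R) (B : nat) : `|cell x| <= B%:Z -> `|x| <= (B%:R + 1) * (pi / 21).
Proof.
have p0 : 0 < pi / 21 :> R by rewrite divr_gt0// pi_gt0.
have /cell_itv/andP[h1 h2] := erefl (cell x).
rewrite !ler_norml => /andP[b1 b2]; apply/andP; split.
  apply: le_trans h1; rewrite -mulNr ler_pM2r//.
  by rewrite -(ler_int R) rmorphN/= in b1; lra.
apply/ltW; apply: lt_le_trans h2 _; rewrite ler_pM2r//.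
by rewrite -(ler_int R) in b2; rewrite intrD; lra.
Qed.

Variables (P S : int -> bool).
Hypothesis Ptrans : forall m, exists k, P (m + 42 * k).
Hypothesis Puniq : forall m j k, P (m + 42 * j) -> P (m + 42 * k) -> j = k.
Hypothesis PS : forall m, P m = S (m %/ 2)%Z && ~~ S m.
Hypothesis Shalf : forall m, S m -> S (m %/ 2)%Z.
Hypotheses (S0 : S 0) (SN1 : S (-1)).
Hypothesis Sb : exists B : nat, forall m, P m || S m -> `|m| <= B%:Z.

Lemma grid_translation_tiling : translation_tiling (grid_set P).
Proof.
split => [x|x j k]; rewrite /grid_set/=.
  by have [k Pk] := Ptrans (cell x); exists k; rewrite cell_translate.
rewrite !cell_translate; exact: Puniq.
Qed.

Lemma grid_dyadic_tiling : dyadic_tiling (grid_set P).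
Proof.
have p0 : 0 < pi / 21 :> R by rewrite divr_gt0// pi_gt0.
apply: (@dyadic_tiling_of_scaling _ _ (S \o cell)) => /=.
- by move=> x; rewrite cell_half; exact: Shalf.
(* The cells -1 and 0 together form the interval [- pi / 21, pi / 21) around the origin. *)
- exists (pi / 21) => // x; rewrite ltr_norml => /andP[x1 x2].
  have [x0|x0] := leP 0 x.
    suff -> : cell x = 0 by []; apply/cell_itv; rewrite mul0r x0/= mul1r//.
  suff -> : cell x = -1 by []; apply/cell_itv; rewrite addNr mul0r x0 andbT mulN1r ltW//.
- have [B SB] := Sb; exists ((B%:R + 1) * (pi / 21)) => x Sx.
  by apply: cell_bounded; apply: SB; rewrite Sx orbT.
- by move=> x; rewrite cell_half /grid_set /= PS.
Qed.

Lemma grid_wavelet_set : wavelet_set (grid_set P).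
Proof.
apply: tiling_wavelet_set.
- exact: measurable_grid_set.
- have [B SB] := Sb; exists ((B%:R + 1) * (pi / 21)) => x Px.
  by apply: cell_bounded; apply: SB; rewrite Px.
- exact: grid_translation_tiling.
- exact: grid_dyadic_tiling.
Qed.

End Grid.

(* Intervals are given by the integers m such that the cell [m pi/21, (m+1) pi/21) belongs to them;
   a translation by 2 pi adds 42 to m. *)
Definition tileE (m : int) : bool :=
  [|| -640 <= m < -624, -78 <= m < -72, -18 <= m < -10 | 12 <= m < 24].

(** Apart from the origin, this is the union of the dilates 2^(- k) E with k >= 1; [scaleF] plays
    the same part for F. *)
Definition scaleE (m : int) : bool :=
  [|| -320 <= m < -312, -160 <= m < -156, -80 <= m < -78, -40 <= m < -36,
      -20 <= m < -18 | -10 <= m < 12].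

Definition tileF (m : int) : bool :=
  [|| -5008 <= m < -5000, -632 <= m < -626, -625 <= m < -624, -160 <= m < -158,
      -152 <= m < -148, -78 <= m < -76, -74 <= m < -72, -18 <= m < -10, 4 <= m < 5,
      12 <= m < 16 | 20 <= m < 24].

Definition scaleF (m : int) : bool :=
  [|| -2504 <= m < -2500, -1252 <= m < -1250, m == -626, -316 <= m < -312,
      -158 <= m < -156, -80 <= m < -78, -76 <= m < -74, -40 <= m < -36,
      -20 <= m < -18, -10 <= m < 4, 5 <= m < 8 | 10 <= m < 12].

Lemma tileE_scale m : tileE m = scaleE (m %/ 2)%Z && ~~ scaleE m.
Proof. rewrite /tileE /scaleE; lia. Qed.

Lemma tileF_scale m : tileF m = scaleF (m %/ 2)%Z && ~~ scaleF m.
Proof. rewrite /tileF /scaleF; lia. Qed.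

Lemma scaleE_half m : scaleE m -> scaleE (m %/ 2)%Z.
Proof. rewrite /scaleE; lia. Qed.

Lemma scaleF_half m : scaleF m -> scaleF (m %/ 2)%Z.
Proof. rewrite /scaleF; lia. Qed.

Lemma tileE_uniq m j k : tileE (m + 42 * j) -> tileE (m + 42 * k) -> j = k.
Proof. rewrite /tileE; lia. Qed.

Lemma tileE_translate m : exists k, tileE (m + 42 * k).
Proof.
(* The residues modulo 42 are cut at 6, 12, 24 and 32. The classes [32, 42) and [0, 6) move to the
   adjacent blocks [-640, -630) and [-630, -624), which form one interval of E. *)
exists (- (m %/ 42)%Z + (if (m %% 42)%Z < 6 then -15 else if (m %% 42)%Z < 12 then -2
  else if (m %% 42)%Z < 24 then 0 else if (m %% 42)%Z < 32 then -1 else -16)).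
rewrite /tileE; do 4?[case: ifP => ?]; lia.
Qed.

(** The multiple of 2 pi that sigma adds on each cell of E. On the pieces 4 y, 2 (y - 21), 8 (y -
    42) and y - 315 it is the dilation factor 4, 2, 8 or 1 times the jump -1, -1, -13 or 15 of the
    cycle, in multiples of 21. *)
Definition shiftE (m : int) : int :=
  if 16 <= m < 20 then -4 else if -76 <= m < -74 then -2
  else if -640 <= m < -632 then -104 else if m == -626 then 15 else 0.

Lemma tileF_shiftE m : tileE m -> tileF (m + 42 * shiftE m).
Proof. rewrite /tileE /tileF /shiftE; do 4?[case: ifP => ?]; lia. Qed.

Lemma tileF_translate m : exists k, tileF (m + 42 * k).
Proof.
have [k /tileF_shiftE Fk] := tileE_translate m.
by exists (k + shiftE (m + 42 * k)); rewrite mulrDr addrA.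
Qed.

Lemma tileF_uniq m j k : tileF (m + 42 * j) -> tileF (m + 42 * k) -> j = k.
Proof. rewrite /tileF; lia. Qed.

(** * Interpolation maps and their domains of congruence *)

Section Interpolation.
Context {R : realType}.
Implicit Types (A B : set R) (s : R).

Lemma interpolation_mapE A B s (n k : int) : translation_tiling B -> dyadic_tiling A -> s != 0 ->
  A ((2 : R) ^ (- n) * s) -> B ((2 : R) ^ (- n) * s + 2 * k%:~R * pi) ->
  interpolation_map A B s = s + 2 * (2 ^ n * k%:~R) * pi.
Proof.
move=> tB dA s0 An Bk; rewrite /interpolation_map (negbTE s0).
have -> : xget 0 [set n : int | A ((2 : R) ^ (- n) * s)] = n.
  by apply: (dA.2 s) => //; apply: (@xgetPex _ 0 [set n : int | A ((2 : R) ^ (- n) * s)]); exists n.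
rewrite (translation_mapP tB Bk) mulrDr mulrA -expfzDr ?pnatr_eq0// subrr expr0z mul1r.
by congr (_ + _); ring.
Qed.

Lemma congruence_domainE A B s (n k : int) : translation_tiling B -> dyadic_tiling A -> s != 0 ->
  A ((2 : R) ^ (- n) * s) -> B ((2 : R) ^ (- n) * s + 2 * k%:~R * pi) ->
  congruence_domain A B s <-> exists j : int, (2 : R) ^ n * k%:~R = j%:~R.
Proof.
move=> tB dA s0 An Bk; rewrite /congruence_domain/= (interpolation_mapE tB dA s0 An Bk).
rewrite addrC addKr.
split=> -[j jE]; exists j; last by rewrite jE.
by move/(mulIf (@pi_neq0 R))/(mulfI _) : jE; apply; rewrite pnatr_eq0.
Qed.

(** For negative p, clearing the denominator would make the odd number o even. *)
Lemma dyadic_integer (p o : int) : odd (absz o) ->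
  (exists j : int, (2 : R) ^ p * o%:~R = j%:~R) <-> 0 <= p.
Proof.
move=> oo; split=> [[j jE]|]; last first.
  case: p => // p _; exists (2 ^+ p * o).
  by rewrite intrM rmorphXn/=.
rewrite leNgt; apply/negP => p0.
case: p p0 jE => // p _ jE.
have : o = 2 * (2 ^+ p * j).
  apply/eqP; rewrite -(eqr_int R) !intrM rmorphXn/= -jE.
  change ((2 : R) ^ Negz p) with ((2 : R) ^- p.+1).
  by rewrite mulrA -exprS mulVKf// expf_neq0// pnatr_eq0.
by move=> oE; move: oo; rewrite oE abszM oddM.
Qed.

(** The displacements of the two maps at s may differ; it is enough that they have the same power of
    2 in front of an odd number, since membership in either domain then means p >= 0. *)
Lemma congruence_domain_sym A B s (n k n' k' p o o' : int) :
  translation_tiling A -> translation_tiling B -> dyadic_tiling A -> dyadic_tiling B -> s != 0 ->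
  A ((2 : R) ^ (- n) * s) -> B ((2 : R) ^ (- n) * s + 2 * k%:~R * pi) ->
  B ((2 : R) ^ (- n') * s) -> A ((2 : R) ^ (- n') * s + 2 * k'%:~R * pi) ->
  (2 : R) ^ n * k%:~R = 2 ^ p * o%:~R -> (2 : R) ^ n' * k'%:~R = 2 ^ p * o'%:~R ->
  odd (absz o) -> odd (absz o') ->
  congruence_domain A B s <-> congruence_domain B A s.
Proof.
move=> tA tB dA dB s0 An Bk Bn' Ak' e e' oo oo'.
rewrite (congruence_domainE tB dA s0 An Bk) (congruence_domainE tA dB s0 Bn' Ak') e e'.
by rewrite !dyadic_integer.
Qed.

Lemma cell_half_dilate s (n : int) :
  cell ((2 : R) ^ (- (n + 1)) * s) = (cell ((2 : R) ^ (- n) * s) %/ 2)%Z.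
Proof. by rewrite exp2z_half cell_half. Qed.

End Interpolation.

Theorem theorem4 : forall R : realType, exists E F : set R,
  [/\ wavelet_set E, wavelet_set F,
      {ae (@lebesgue_measure R),
        forall s, congruence_domain E F s <-> congruence_domain F E s} &
      ~ interpolation_pair E F].
Proof.
move=> R.
have bndE : exists B : nat, forall m, tileE m || scaleE m -> `|m| <= B%:Z.
  by exists 640%N => m; rewrite /tileE /scaleE; lia.
have bndF : exists B : nat, forall m, tileF m || scaleF m -> `|m| <= B%:Z.
  (* The lowest cell of F is -5008. *)
  by exists (3000 + 3000)%N => m; rewrite /tileF /scaleF; lia.
have wE : wavelet_set (grid_set tileE : set R).
  exact: (grid_wavelet_set tileE_translate tileE_uniq tileE_scale scaleE_half).
have wF : wavelet_set (grid_set tileF : set R).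
  exact: (grid_wavelet_set tileF_translate tileF_uniq tileF_scale scaleF_half).
have tE : translation_tiling (grid_set tileE : set R).
  exact: grid_translation_tiling tileE_translate tileE_uniq.
have tF : translation_tiling (grid_set tileF : set R).
  exact: grid_translation_tiling tileF_translate tileF_uniq.
have dE : dyadic_tiling (grid_set tileE : set R).
  exact: (grid_dyadic_tiling tileE_scale scaleE_half).
have dF : dyadic_tiling (grid_set tileF : set R).
  exact: (grid_dyadic_tiling tileF_scale scaleF_half).
(* Splits a jump k into 2^c times its odd part o, so that p = n + c is the exponent of the whole
   displacement. *)
have p2 (n k p c o : int) : n + c = p -> k%:~R = (2 : R) ^ c * o%:~R ->
    (2 : R) ^ n * k%:~R = 2 ^ p * o%:~R.
  by move=> <- ->; rewrite mulrA -expfzDr ?pnatr_eq0.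
exists (grid_set tileE), (grid_set tileF); split => //.
- exists [set 0]; split; [exact: measurable_set1|exact: lebesgue_measure_set1|].
  move=> s; apply: contra_notP => /eqP s0 /=.
  have [n En] := dE.1 s s0.
  pose m := cell ((2 : R) ^ (- n) * s).
  have Em : tileE m by exact: En.
  have Fm : grid_set tileF ((2 : R) ^ (- n) * s + 2 * (shiftE m)%:~R * pi).
    by rewrite /grid_set/= cell_translate; exact: tileF_shiftE.
  (* [2 ^ (- n') * s] is the representative of [s] in F, and [k'] its translation into E. *)
  have [m1|nm1] := boolP (16 <= m < 20).
    (* Here 2^(- n) s is a point 4 y. The corresponding point of F is y, the image of y - 315,
       whence [n'] = n + 2 and [k'] = -15; the exponent is split so that [cell_half_dilate] applies
       twice. *)
    apply: (congruence_domain_sym (n' := n + 1 + 1) (k' := -15) (p := n + 2) (o := -1) (o' := -15)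
      tE tF dE dF s0 En Fm); [| | | |by []|by []].
    + rewrite /grid_set/= !cell_half_dilate -/m /tileF; lia.
    + rewrite /grid_set/= cell_translate !cell_half_dilate -/m /tileE; lia.
    + apply: (p2 _ _ _ 2); first by []. rewrite /shiftE m1; lra.
    + by apply: (p2 _ _ _ 0); [lia|rewrite expr0z mul1r].
  have [m2|nm2] := boolP (-76 <= m < -74).
    (* Here 2^(- n) s is a point 2 (y - 21). The corresponding point of F is 4 (y - 21), the image
       of 4 y. *)
    have mh : m = (cell ((2 : R) ^ (- (n - 1)) * s) %/ 2)%Z by rewrite -cell_half_dilate subrK.
    apply: (congruence_domain_sym (n' := n - 1) (k' := 4) (p := n + 1) (o := -1) (o' := 1)
      tE tF dE dF s0 En Fm); [| | | |by []|by []].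
    + rewrite /grid_set/= /tileF; lia.
    + rewrite /grid_set/= cell_translate /tileE; lia.
    + apply: (p2 _ _ _ 1); first by []. rewrite /shiftE (negbTE nm1) m2; lra.
    + by apply: (p2 _ _ _ 2); [lia|lra].
  have [m3|nm3] := boolP (-640 <= m < -632).
    (* Here 2^(- n) s is a point 8 (y - 42). The corresponding point of F is 2 (y - 42), the image
       of 2 (y - 21). *)
    apply: (congruence_domain_sym (n' := n + 1 + 1) (k' := 2) (p := n + 3) (o := -13) (o' := 1)
      tE tF dE dF s0 En Fm); [| | | |by []|by []].
    + rewrite /grid_set/= !cell_half_dilate -/m /tileF; lia.
    + rewrite /grid_set/= cell_translate !cell_half_dilate -/m /tileE; lia.
    + apply: (p2 _ _ _ 3); first by []. rewrite /shiftE (negbTE nm1) (negbTE nm2) m3; lra.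
    + by apply: (p2 _ _ _ 1); [lia|lra].
  have [m4|nm4] := eqVneq m (-626).
    (* Here 2^(- n) s is a point y - 315. The corresponding point of F is 8 (y - 315), the image of
       8 (y - 42), at distance 8 times 13 times 2 pi. *)
    have mh : m = (((cell ((2 : R) ^ (- (n - 3)) * s) %/ 2)%Z %/ 2)%Z %/ 2)%Z.
      by rewrite -!cell_half_dilate (_ : n - 3 + 1 + 1 + 1 = n)//; lia.
    apply: (congruence_domain_sym (n' := n - 3) (k' := 104) (p := n) (o := 15) (o' := 13)
      tE tF dE dF s0 En Fm); [| | | |by []|by []].
    + rewrite /grid_set/= /tileF; lia.
    + rewrite /grid_set/= cell_translate /tileE; lia.
    + apply: (p2 _ _ _ 0); first by rewrite addr0.
      by rewrite /shiftE (negbTE nm1) (negbTE nm2) (negbTE nm3) m4 eqxx expr0z mul1r.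
    + by apply: (p2 _ _ _ 3); [lia|lra].
  (* Off the four pieces 2^(- n) s lies in both E and F, and both displacements vanish. *)
  have m0 : shiftE m = 0.
    by rewrite /shiftE (negbTE nm1) (negbTE nm2) (negbTE nm3) (negbTE nm4).
  have Z0 (x : R) : x + 2 * 0%:~R * pi = x by rewrite mulr0 mul0r addr0.
  rewrite m0 Z0 in Fm.
  have En0 : grid_set tileE ((2 : R) ^ (- n) * s + 2 * 0%:~R * pi) by rewrite Z0.
  have Fm0 : grid_set tileF ((2 : R) ^ (- n) * s + 2 * 0%:~R * pi) by rewrite Z0.
  apply: iff_trans (congruence_domainE tF dE s0 En Fm0) _.
  exact: iff_sym (congruence_domainE tE dF s0 Fm En0).
- move=> [N [mN N0 sub]].
  (* The first cell of the piece 4 y: a set of positive measure on which sigma applied twice moves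
     every point. *)
  pose I : set R := `[16 * (pi / 21), 17 * (pi / 21)[%classic.
  have p0 : 0 < pi / 21 :> R by rewrite divr_gt0// pi_gt0.
  have muI : lebesgue_measure I = (pi / 21)%:E :> \bar R.
    rewrite lebesgue_measure_itv/= lte_fin ifT; last by rewrite ltr_pM2r//; lra.
    by rewrite -EFinB; congr EFin; ring.
  have IN : I `<=` N.
    move=> s Is; apply: sub => /= ss.
    have c16 : cell s = 16.
      by apply/cell_itv; move: Is; rewrite /I/= in_itv/=.
    have cell0 : cell (0 : R) = 0 by apply/cell_itv; rewrite mul0r lexx mul1r.
    have s0 : s != 0 by apply/eqP => sE; rewrite sE cell0 in c16.
    have cs : cell (s + 2 * (2 ^ 0 * (-4)%:~R) * pi) = -152.
      by rewrite expr0z mul1r cell_translate c16.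
    have s1 : s + 2 * (2 ^ 0 * (-4)%:~R) * pi != 0 by apply/eqP => sE; rewrite sE cell0 in cs.
    have cd (x : R) : 2 ^ (- 0) * x = x by rewrite oppr0 expr0z mul1r.
    have c2 x : cell ((2 : R) ^ (- (1 : int)) * x) = (cell x %/ 2)%Z.
      by have := cell_half_dilate x 0; rewrite add0r cd.
    have S1 : interpolation_map (grid_set tileE) (grid_set tileF) s =
        s + 2 * (2 ^ 0 * (-4)%:~R) * pi.
      apply: (interpolation_mapE tF dE s0); rewrite /grid_set/= ?cell_translate cd c16//.
    (* The image lies in cell -152, hence in the dilate 2 E by way of cell -76; the jump -2 there is
       doubled, and the total displacement is -8 times 2 pi. *)
    have S2 : interpolation_map (grid_set tileE) (grid_set tileF)
          (s + 2 * (2 ^ 0 * (-4)%:~R) * pi) =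
        s + 2 * (2 ^ 0 * (-4)%:~R) * pi + 2 * (2 ^ (1 : int) * (-2)%:~R) * pi.
      by apply: (interpolation_mapE tF dE s1); rewrite /grid_set/= ?cell_translate c2 cs.
    move: ss; rewrite S1 S2 expr0z expr1z mul1r; move: (pi : R) (@pi_gt0 R) => p pp.
    rewrite -[X in _ = X]addr0 -addrA => /addrI; lra.
  have : (lebesgue_measure I <= lebesgue_measure N)%E.
    by apply: le_measure => //; rewrite inE//; exact: measurable_itv.
  by rewrite [X in (_ <= X)%E]N0 muI lee_fin leNgt p0.
Qed.
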